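(* Let $g:\mathbb{R}\times\mathscr{P}_2(\mathbb{R})\to\mathbb{R}$ be differentiable in its first variable $x$, with derivative $g_x$, and suppose there is a constant $C_g$ such that: (1) $|g_x(x,m)-g_x(x',m)|\le C_g|x-x'|$ for all $x,x'\in\mathbb{R}$, $m\in\mathscr{P}_2(\mathbb{R})$; (2) $(g_x(x,m)-g_x(x',m))(x-x')\ge 0$ for all $x,x'\in\mathbb{R}$, $m\in\mathscr{P}_2(\mathbb{R})$; (3) $|g_x(x,m)-g_x(x,m')|\le C_g W_2(m,m')$ for all $x\in\mathbb{R}$, $m,m'\in\mathscr{P}_2(\mathbb{R})$; (4) for all $m,m'\in\mathscr{P}_2(\mathbb{R})$ and every $\gamma\in\mathscr{P}_2(\mathbb{R}^2)$ with marginals $m$ and $m'$ respectively, $\int_{\mathbb{R}^2}(g_x(x,m)-g_x(y,m'))(x-y)\,\gamma(dx,dy)\ge 0$. Then the $\tilde\sigma$-MFG with initial condition $\xi_0\in\mathscr{L}^2_{\mathscr{F}_0}$ has at most one solution, i.e. any two solutions coincide as elements of $\mathscr{H}^2([0,T];\mathbb{R})$.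
   Context: $\mathscr{P}_2(\mathbb{R}^d)$ is the set of Borel probability measures on $\mathbb{R}^d$ with finite second moment, and $W_2$ is the second-order Wasserstein metric on $\mathscr{P}_2(\mathbb{R})$: $W_2(m_1,m_2)=\left(\inf_\gamma\int_{\mathbb{R}^2}|x-y|^2\gamma(dx,dy)\right)^{1/2}$, the infimum being over probability measures $\gamma$ on $\mathbb{R}^2$ with marginals $m_1,m_2$. Fix $T>0$ and real constants $\sigma,\tilde\sigma$. On a complete probability space $(\Omega,\mathscr{F},\mathbb{P})$ let $W=(W_t)_{0\le t\le T}$ and $\tilde W=(\tilde W_t)_{0\le t\le T}$ be independent one-dimensional Brownian motions and let $\xi_0$ be a square-integrable random variable independent of $(W,\tilde W)$. $\mathscr{F}_t$ is generated by $\xi_0,(W_s)_{0\le s\le t},(\tilde W_s)_{0\le s\le t}$ and $\tilde{\mathscr{F}}_t$ is generated by $(\tilde W_s)_{0\le s\le t}$, both augmented by the $\mathbb{P}$-null sets. $\mathscr{L}^2_{\mathscr{F}_t}$ is the set of square-integrable $\mathscr{F}_t$-measurable random variables; $\mathscr{H}^2([0,T];\mathbb{R})$ is the set of $(\mathscr{F}_t)$-progressively measurable real processes $\beta$ on $[0,T]$ with $\mathbb{E}\int_0^T\beta_t^2\,dt<\infty$ (processes equal $dt\otimes\mathbb{P}$-a.e. are identified). For $\alpha\in\mathscr{H}^2([0,T];\mathbb{R})$ let $X^\alpha_t=\xi_0+\int_0^t\alpha_r\,dr+\sigma W_t+\tilde\sigma\tilde W_t$ and $m^\alpha_t=\mathcal{L}(X^\alpha_t\mid\tilde{\mathscr{F}}_t)$,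 the (regular) conditional law of $X_t^\alpha$ given $\tilde{\mathscr{F}}_t$, which lies in $\mathscr{P}_2(\mathbb{R})$ a.s. For $\alpha,\hat\alpha\in\mathscr{H}^2([0,T];\mathbb{R})$ put $$J(\alpha\mid m^{\hat\alpha})=\mathbb{E}\left[\int_0^T\frac{\alpha_t^2}{2}\,dt+g(X^\alpha_T,m^{\hat\alpha}_T)\right].$$ It is understood that these costs are well defined and finite: $g$ is Borel measurable and $g(X^\alpha_T,m^{\hat\alpha}_T)$ is integrable for all $\alpha,\hat\alpha\in\mathscr{H}^2([0,T];\mathbb{R})$. A solution to the $\tilde\sigma$-MFG (mean field game with common noise) with initial $\xi_0$ is a control $\hat\alpha\in\mathscr{H}^2([0,T];\mathbb{R})$ such that $J(\hat\alpha\mid m^{\hat\alpha})\le J(\alpha\mid m^{\hat\alpha})$ for all $\alpha\in\mathscr{H}^2([0,T];\mathbb{R})$ (the flow $m^{\hat\alpha}$ being held fixed). *)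

(* Defs.v *)
From HB Require Import structures.
From mathcomp Require Import all_boot all_order all_algebra.
From mathcomp Require Import all_classical all_reals all_analysis.
(* all_analysis does not export the sigma-algebra on [\bar R]. *)
From mathcomp Require Import measurable_realfun.

Set Implicit Arguments.
Unset Strict Implicit.
Unset Printing Implicit Defensive.

Import Order.TTheory GRing.Theory Num.Theory.
Import numFieldNormedType.Exports.

Local Open Scope classical_set_scope.
Local Open Scope ring_scope.

Record P2 (R : realType) := MkP2 {
  P2_law :> probability R R;
  P2_moment : (\int[P2_law]_x (x ^+ 2)%:E < +oo)%E }.

Definition coupling (R : realType) (m1 m2 : probability R R)
    (gamma : probability (R * R)%type R) : Prop :=
  (forall A, measurable A -> gamma (fst @^-1` A) = m1 A) /\
  (forall A, measurable A -> gamma (snd @^-1` A) = m2 A).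

(* On P2 the infimum is finite: the product coupling has finite cost. *)
Definition W2 (R : realType) (m1 m2 : P2 R) : R :=
  Num.sqrt (fine (ereal_inf
    [set \int[gamma]_p (`|p.1 - p.2| ^+ 2)%:E | gamma in coupling m1 m2]))%E.

(* Open sets of R x P2 for the product of the usual metric and W2. *)
Definition open_RxP2 (R : realType) : set (set (R * P2 R)) :=
  [set U | forall p, U p -> exists2 e : R, 0 < e &
    forall q, `|p.1 - q.1| < e -> W2 p.2 q.2 < e -> U q].

(* Two elements of P2 that agree on Borel sets may differ on other sets; their
   W2 distance is 0, so that a Borel measurable [g] does not separate them. *)
Definition borel_measurable (R : realType) (g : R -> P2 R -> R) : Prop :=
  forall B : set R, measurable B ->
    <<s @open_RxP2 R >> [set p | B (g p.1 p.2)].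

Definition partial_x (R : realType) (g : R -> P2 R -> R) (x : R) (m : P2 R) : R :=
  derive1 (fun y : R => g y m) x.

Section stochastic_basis.
Context (R : realType) (d : measure_display) (Omega : measurableType d).
Variable P : probability Omega R.

Definition indep (F G : set (set Omega)) : Prop :=
  forall A B, F A -> G B -> P (A `&` B) = (P A * P B)%E.

Definition sigma_rv (Y : Omega -> R) : set (set Omega) :=
  g_sigma_algebra_preimage Y.

Definition sigma_process (D : set R) (Y : R -> Omega -> R) : set (set Omega) :=
  <<s \bigcup_(s in D) sigma_rv (Y s) >>.

Record brownian (T : R) (W : R -> Omega -> R) : Prop := {
  brownian_measurable : forall t, 0 <= t <= T -> measurable_fun setT (W t);
  brownian_start : {ae P, forall w, W 0 w = 0};
  brownian_continuous :
    {ae P, forall w, {within `[0, T], continuous (fun t : R => W t w)}};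
  brownian_gaussian : forall s t, 0 <= s -> s < t -> t <= T ->
    forall B : set R, measurable B ->
    P [set w | B (W t w - W s w)] = normal_prob 0 (Num.sqrt (t - s)) B;
  brownian_indep : forall s t, 0 <= s -> s < t -> t <= T ->
    indep (sigma_rv (W t \- W s)) (sigma_process `[0, s] W) }.

Definition filtration (xi0 : Omega -> R) (W Wt : R -> Omega -> R) (t : R) :
    set (set Omega) :=
  <<s sigma_rv xi0 `|` sigma_process `[0, t] W `|` sigma_process `[0, t] Wt
      `|` P.-negligible >>.

Definition common_filtration (Wt : R -> Omega -> R) (t : R) : set (set Omega) :=
  <<s sigma_process `[0, t] Wt `|` P.-negligible >>.

(* [g_sigma_algebraType (F t)] is [Omega] equipped with the sigma-algebra
   generated by [F t]. *)
Definition progressive (T : R) (F : R -> set (set Omega))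
    (b : R -> Omega -> R) : Prop :=
  forall t, 0 <= t <= T ->
    measurable_fun (`[0, t] `*` setT : set (R * g_sigma_algebraType (F t)))
      (fun p => b p.1 p.2).

Definition H2 (T : R) (F : R -> set (set Omega)) (b : R -> Omega -> R) : Prop :=
  progressive T F b /\
  (\int[P]_w \int[lebesgue_measure]_(t in `[0%R, T]) ((b t w) ^+ 2)%:E < +oo)%E.

Definition H2_eq (T : R) (a b : R -> Omega -> R) : Prop :=
  {ae (@lebesgue_measure R \x P)%E, forall p : R * Omega,
    0 <= p.1 <= T -> a p.1 p.2 = b p.1 p.2}.

(* Paths [a ^~ w] of a process in H2 are integrable for almost every [w]; on the
   exceptional null set the Rintegral has a default value. *)
Definition state (sigma sigmat : R) (xi0 : Omega -> R) (W Wt : R -> Omega -> R)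
    (a : R -> Omega -> R) (t : R) (w : Omega) : R :=
  xi0 w + \int[lebesgue_measure]_(r in `[0, t]) a r w
    + sigma * W t w + sigmat * Wt t w.

(* [m] is a version of the conditional law of [Y] given the sigma-algebra [F],
   with [F] a sigma-algebra containing the null sets: since the conditional law
   is a.s. in P2, versions can be taken P2-valued everywhere. *)
Definition is_cond_law (F : set (set Omega)) (Y : Omega -> R)
    (m : Omega -> P2 R) : Prop :=
  forall B : set R, measurable B ->
    measurable_fun (setT : set (g_sigma_algebraType F)) (fun w => m w B) /\
    forall A, F A -> (\int[P]_(w in A) m w B = P (A `&` Y @^-1` B))%E.

Definition is_cond_flow (T : R) (F : R -> set (set Omega))
    (X : R -> Omega -> R) (m : R -> Omega -> P2 R) : Prop :=
  forall t, 0 <= t <= T -> is_cond_law (F t) (X t) (m t).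

Definition cost (T : R) (g : R -> P2 R -> R) (a X : R -> Omega -> R)
    (m : R -> Omega -> P2 R) : \bar R :=
  (\int[P]_w (\int[lebesgue_measure]_(t in `[0%R, T]) ((a t w) ^+ 2 / 2)%:E
              + (g (X T w) (m T w))%:E))%E.

(* The cost depends on [m] only up to null sets, so it does not matter which
   version of the flow of conditional laws is used. *)
Definition mfg_solution (T sigma sigmat : R) (xi0 : Omega -> R)
    (W Wt : R -> Omega -> R) (g : R -> P2 R -> R) (ah : R -> Omega -> R) : Prop :=
  let X := state sigma sigmat xi0 W Wt in
  let F := filtration xi0 W Wt in
  H2 T F ah /\
  exists2 m : R -> Omega -> P2 R,
    is_cond_flow T (common_filtration Wt) (X ah) m &
    forall a, H2 T F a -> (cost T g ah (X ah) m <= cost T g a (X a) m)%E.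

Definition finite_costs (T sigma sigmat : R) (xi0 : Omega -> R)
    (W Wt : R -> Omega -> R) (g : R -> P2 R -> R) : Prop :=
  let X := state sigma sigmat xi0 W Wt in
  let F := filtration xi0 W Wt in
  borel_measurable g /\
  forall a ah, H2 T F a -> H2 T F ah ->
    forall m, is_cond_flow T (common_filtration Wt) (X ah) m ->
    P.-integrable setT (fun w => (g (X a T w) (m T w))%:E).

End stochastic_basis.

(* Main.v *)
Require Import Defs.
From HB Require Import structures.
From mathcomp Require Import all_boot all_order all_algebra.
From mathcomp Require Import all_classical all_reals all_analysis.
From mathcomp Require Import measurable_realfun.
From mathcomp Require Import giry ring lra.

(* Comparing the optimum a with a + e (b - a), and b with b + e (a - b), adding
   the two inequalities and letting e tend to 0 gives
     E \int (b - a)^2 <= E (g_x(X^a, m^a) - g_x(X^b, m^b)) (X^b - X^a)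
   at time T, and the right-hand side is nonpositive by displacement
   monotonicity applied conditionally on the common noise.  This last step does
   not need a regular conditional law of the pair (X^a, X^b): Omega is cut into
   finitely many events A of the common filtration on which the conditional
   laws hardly vary for W2, the monotonicity is applied to the law of (X^a, X^b)
   given A, and the W2-Lipschitz bound on g_x controls the error made in
   replacing m^a and m^b on A by the laws of X^a and X^b given A. *)

Set Implicit Arguments.
Unset Strict Implicit.
Unset Printing Implicit Defensive.

Import Order.TTheory GRing.Theory Num.Theory.
Import numFieldNormedType.Exports.

Local Open Scope classical_set_scope.
Local Open Scope ring_scope.

(** * Couplings *)

(** The random variable w -> g_x(X w, m w) is not shown to be measurable, so its expectation is
    never formed. The interpolation parameter e stays fixed: the difference quotients of g, minus
    the second-order error 2 e Cg |X^b - X^a|^2, form an integrable variable G below (g_x(X^a, m^a)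
    - g_x(X^b, m^b)) (X^b - X^a), and what is proved is E G <= 0. For the same reason the Lipschitz
    error is split by W2 |Y - X| <= k |Y - X|^2 + W2^2 / k, and W2^2 is then bounded by the cost of
    an explicit coupling, which is an ordinary integral.

    To obtain finitely many events A, real values are rounded to a finite set of points x_i. A law
    becomes a vector of numbers in [0, 1], and cutting [0, 1] into short intervals partitions Omega.
    Two weight vectors that are e-close give laws whose W2^2 is at most e times the sum of all |x_i
    - x_l|^2; this sum depends on the rounding, so the mesh e is chosen after it. *)

(** A finite sum of scaled Dirac masses. The sum of measures [msum] runs over natural numbers, so
    [I] is enumerated, with [i0] as the default of [nth]. *)
Lemma discrete_probability (R : realType) (d : measure_display)
    (T : measurableType d) (I : finType) (i0 : I) (c : I -> R) (z : I -> T) :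
  (forall i, 0 <= c i) -> \sum_i c i = 1 ->
  exists gamma : probability T R,
    (forall A, gamma A = \sum_i (c i)%:E * \d_(z i) A)%E /\
    (forall f : T -> R, measurable_fun setT f -> (forall x, 0 <= f x) ->
       (\int[gamma]_x (f x)%:E)%E = (\sum_i c i * f (z i))%:E).
Proof.
move=> c0 c1.
pose e (k : nat) : I := nth i0 (enum I) k.
pose m_ (k : nat) : {measure set T -> \bar R} :=
  mscale (NngNum (c0 (e k))) (\d_(z (e k))).
have sumE (F : I -> \bar R) :
    (\sum_(k < #|I|) F (e k) = \sum_i F i)%E.
  rewrite (eq_bigr (fun k : 'I_#|I| => F (enum_val k))); last first.
    by move=> k _; rewrite /e (enum_val_nth i0).
  by rewrite -big_enum_val; exact: eq_bigl.
have mE A : msum m_ #|I| A = (\sum_i (c i)%:E * \d_(z i) A)%E.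
  by rewrite /msum -sumE.
have mT : msum m_ #|I| setT = 1%E.
  rewrite mE (eq_bigr (fun i => (c i)%:E)); last first.
    by move=> i _; rewrite diracT mule1.
  by rewrite sumEFin c1.
pose mixin := Measure_isProbability.Build _ _ _ (msum m_ #|I|) mT.
pose gamma : probability T R := HB.pack (msum m_ #|I|) mixin.
exists gamma; split; first exact: mE.
move=> f mf f0; rewrite ge0_integral_measure_sum//.
- rewrite -sumEFin -sumE; apply: eq_bigr => k _.
  rewrite /m_ ge0_integral_mscale//=.
  + rewrite integral_dirac//; last exact/measurable_EFinP.
    by rewrite diracT mul1e EFinM.
  + exact/measurable_EFinP.
  + by move=> x _; rewrite lee_fin.
- by move=> x _; rewrite lee_fin.
- exact/measurable_EFinP.
Qed.

(** The real bound [c] makes the infimum finite, so that [fine] in [W2] does not replace an infinite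
    value by 0. *)
Lemma sqr_W2_le (R : realType) (m1 m2 : P2 R)
    (gamma : probability (R * R)%type R) (c : R) :
  coupling m1 m2 gamma ->
  (\int[gamma]_p (`|p.1 - p.2| ^+ 2)%:E <= c%:E)%E -> W2 m1 m2 ^+ 2 <= c.
Proof.
move=> cpl le_c; rewrite /W2.
set S := ereal_inf _.
have S0 : (0 <= S)%E.
  apply: le_ereal_inf_tmp => _ [g _ <-].
  by apply: integral_ge0 => p _; rewrite lee_fin sqr_ge0.
have Sc : (S <= c%:E)%E.
  by apply: le_trans le_c; apply: ereal_inf_lbound; exists gamma.
have Sfin : S \is a fin_num by rewrite ge0_fin_numE// (le_lt_trans Sc) ?ltry.
by rewrite sqr_sqrtr ?fine_ge0// -lee_fin fineK.
Qed.

Lemma measurable_diff_sqr (R : realType) :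
  measurable_fun setT (fun p : R * R => `|p.1 - p.2| ^+ 2).
Proof.
apply: measurable_funX; apply: measurableT_comp => //.
exact: measurable_funB.
Qed.

(* The mass common to [p] and [q] stays on the diagonal; the leftovers, both of
   mass [r], are coupled independently. *)
Lemma finite_coupling_weights (R : realType) (I : finType) (p q : I -> R) (e : R) :
  (forall i, 0 <= p i) -> (forall i, 0 <= q i) ->
  \sum_i p i = 1 -> \sum_i q i = 1 -> (forall i, `|p i - q i| <= e) ->
  exists c : I * I -> R,
    [/\ forall ij, 0 <= c ij, forall i, \sum_j c (i, j) = p i,
        forall j, \sum_i c (i, j) = q j
      & forall i j, i != j -> c (i, j) <= e].
Proof.
move=> p0 q0 p1 q1 pq.
pose s i := Order.min (p i) (q i).
pose r := \sum_i (p i - s i).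
have sp i : 0 <= p i - s i by rewrite subr_ge0 /s ge_min lexx.
have sq i : 0 <= q i - s i by rewrite subr_ge0 /s ge_min lexx orbT.
have s0 i : 0 <= s i by rewrite /s le_min p0 q0.
have rE : r = \sum_i (q i - s i) by rewrite /r !sumrB p1 q1.
have r0 : 0 <= r by rewrite sumr_ge0.
have pr i : p i - s i <= r by rewrite /r (bigD1 i)//= lerDl sumr_ge0.
have qr i : q i - s i <= r by rewrite rE (bigD1 i)//= lerDl sumr_ge0.
(* If [r = 0], all leftovers vanish, and division by 0 returning 0 makes the product part of the
   coupling vanish as well. *)
have rK x : 0 <= x <= r -> x * r / r = x.
  move=> /andP[x0 xr]; have [r00|rn0] := eqVneq r 0; last by rewrite mulfK.
  by rewrite r00 mulr0 mul0r; apply/esym/eqP; rewrite eq_le x0 andbT -r00.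
have pe i : p i - s i <= e.
  apply: le_trans (pq i); rewrite /s; case: (leP (p i) (q i)) => _.
    by rewrite subrr.
  exact: ler_norm.
pose c (ij : I * I) := (if ij.1 == ij.2 then s ij.1 else 0) +
  (p ij.1 - s ij.1) * (q ij.2 - s ij.2) / r.
exists c; split.
- move=> [i j]; rewrite /c/= addr_ge0//; first by case: ifP.
  by rewrite divr_ge0// mulr_ge0.
- move=> i; rewrite /c/= big_split/= -big_mkcond/= (big_pred1 i) => [|j]; last first.
    by rewrite /= eq_sym.
  rewrite -mulr_suml -mulr_sumr -rE rK ?sp ?pr//; lra.
- move=> j; rewrite /c/= big_split/= -big_mkcond/= (big_pred1 j)//.
  rewrite -mulr_suml -mulr_suml -/r.
  by rewrite [r * _]mulrC rK ?sq ?qr//; lra.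
(* Off the diagonal only the product part remains; since (q_j - s_j) / r <= 1, it is at most the
   leftover p_i - s_i <= e. *)
- move=> i j ij; rewrite /c/= (negbTE ij) add0r; apply: le_trans (pe i).
  rewrite -mulrA ler_piMr//.
  have [r00|rn0] := eqVneq r 0; first by rewrite r00 invr0 mulr0.
  by rewrite ler_pdivrMr ?lt_def ?rn0// mul1r.
Qed.

(** Mass kept on the diagonal is transported for free, and every other pair of points carries at
    most [e]. *)
Lemma sqr_W2_discrete (R : realType) (I : finType) (x p q : I -> R) (e : R)
    (m1 m2 : P2 R) :
  (forall i, 0 <= p i) -> (forall i, 0 <= q i) ->
  \sum_i p i = 1 -> \sum_i q i = 1 -> (forall i, `|p i - q i| <= e) -> 0 <= e ->
  (forall A, measurable A -> m1 A = \sum_i (p i)%:E * \d_(x i) A)%E ->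
  (forall A, measurable A -> m2 A = \sum_i (q i)%:E * \d_(x i) A)%E ->
  W2 m1 m2 ^+ 2 <= e * \sum_i \sum_j `|x i - x j| ^+ 2.
Proof.
move=> p0 q0 p1 q1 pq e0 m1E m2E.
have [c [c0 cp cq ce]] := finite_coupling_weights p0 q0 p1 q1 pq.
have [i0 _] : exists i0 : I, True.
  have [n|i0] := pickP (@predT I); first by exists n.
  by move: p1; rewrite big1 => [/esym/eqP|i]; rewrite ?oner_eq0//; have := i0 i.
have c1 : \sum_ij c ij = 1.
  rewrite -p1; under [RHS]eq_bigr do rewrite -cp.
  by rewrite pair_big; apply: eq_bigr; case.
have [g [gE gint]] :=
  discrete_probability (i0, i0) (fun ij => (x ij.1, x ij.2)) c0 c1.
apply: (@sqr_W2_le _ _ _ g).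
  split => A mA; rewrite gE.
    rewrite m1E// [RHS](eq_bigr (fun i => \sum_j (c (i, j))%:E * \d_(x i) A)%E).
      by rewrite pair_big; apply: eq_bigr; case.
    move=> i _; rewrite -ge0_sume_distrl//=; last by move=> j _; rewrite lee_fin.
    by rewrite sumEFin cp.
  rewrite m2E// [RHS](eq_bigr (fun j => \sum_i (c (i, j))%:E * \d_(x j) A)%E).
    by rewrite exchange_big pair_big; apply: eq_bigr; case.
  move=> i _; rewrite -ge0_sume_distrl//=; last by move=> j _; rewrite lee_fin.
  by rewrite sumEFin cq.
rewrite (gint _ (@measurable_diff_sqr R)) => [|?]; last exact: sqr_ge0.
rewrite lee_fin pair_big mulr_sumr; apply: ler_sum => -[i j] _ /=.
have [->|ij] := eqVneq i j; first by rewrite subrr normr0 expr0n/= !mulr0.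
by rewrite ler_wpM2r ?sqr_ge0 ?ce.
Qed.

(** * Conditioning and rounding *)

Lemma pushforward_probability (R : realType) (d1 d2 : measure_display)
    (T1 : measurableType d1) (T2 : measurableType d2) (P : probability T1 R)
    (f : T1 -> T2) :
  measurable_fun setT f ->
  exists Q : probability T2 R,
    [/\ forall A, Q A = P (f @^-1` A),
        forall h : T2 -> \bar R, measurable_fun setT h -> (forall y, 0 <= h y)%E ->
          (\int[Q]_y h y = \int[P]_x h (f x))%E
      & forall h : T2 -> \bar R, measurable_fun setT h ->
          P.-integrable setT (h \o f) ->
          (\int[Q]_y h y = \int[P]_x h (f x))%E].
Proof.
move=> mf; pose X : {mfun T1 >-> T2} := mfun_Sub (mem_set mf).
exists (distribution P X); split => //.
- by move=> h mh h0; exact: ge0_integral_distribution.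
- by move=> h mh ih; exact: integral_distribution.
Qed.

Lemma law_in_P2 (R : realType) (d : measure_display) (T : measurableType d)
    (P : probability T R) (X : T -> R) :
  measurable_fun setT X -> (\int[P]_w ((X w) ^+ 2)%:E < +oo)%E ->
  exists m : P2 R, forall A, m A = P (X @^-1` A).
Proof.
move=> mX X2; have [Q [QE Qint _]] := pushforward_probability P mX.
suff Q2 : (\int[Q]_x (x ^+ 2)%:E < +oo)%E by exists (MkP2 Q2).
rewrite Qint//; last by move=> y; rewrite lee_fin sqr_ge0.
by apply/measurable_EFinP; exact: exprn_measurable.
Qed.

Lemma sqr_W2_pushforward (R : realType) (d : measure_display)
    (T : measurableType d) (P : probability T R) (X Y : T -> R) (m1 m2 : P2 R)
    (c : R) :
  measurable_fun setT X -> measurable_fun setT Y ->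
  (forall A, measurable A -> m1 A = P (X @^-1` A)) ->
  (forall A, measurable A -> m2 A = P (Y @^-1` A)) ->
  (\int[P]_w (`|X w - Y w| ^+ 2)%:E <= c%:E)%E ->
  W2 m1 m2 ^+ 2 <= c.
Proof.
move=> mX mY m1E m2E le_c.
have [Q [QE Qint _]] :=
  pushforward_probability P (measurable_fun_pair mX mY).
apply: (@sqr_W2_le _ _ _ Q).
  by split => A mA; rewrite QE ?m1E ?m2E.
rewrite Qint//.
by apply/measurable_EFinP; exact: measurable_diff_sqr.

Qed.

Lemma conditioned_probability (R : realType) (d : measure_display)
    (T : measurableType d) (P : probability T R) (A : set T) :
  measurable A -> P A != 0%E ->
  exists Q : probability T R,
    (forall B, Q B = (fine (P A))^-1%:E * P (B `&` A))%E /\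
    (forall h : T -> \bar R, measurable_fun setT h ->
      (forall y, (0 <= h y)%E) ->
      (\int[Q]_y h y = (fine (P A))^-1%:E * \int[P]_(x in A) h x)%E).
Proof.
move=> mA PA0.
have PAfin : P A \is a fin_num by exact: fin_num_measure.
have pA0 : fine (P A) != 0 by rewrite fine_eq0.
have pAi : 0 <= (fine (P A))^-1 by rewrite invr_ge0 fine_ge0.
pose m := mscale (NngNum pAi) (mrestr P mA).
have mT : m setT = 1%E.
  rewrite /m/= /mscale/= /mrestr setTI -[X in (_ * X)%E](fineK PAfin) -EFinM.
  by rewrite mulVf.
pose mixin := Measure_isProbability.Build _ _ _ m mT.
pose Q : probability T R := HB.pack m mixin.
exists Q; split => // h mh h0.
rewrite /Q/= ge0_integral_mscale//; congr (_ * _)%E.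
rewrite -(setvU A) ge0_integral_setU//=; last 3 first.
- exact: measurableC.
- by rewrite setvU.
- by rewrite disj_set2E setICl.
rewrite (eq_measure_integral (@mzero _ T R)); last first.
  by move=> B _ BA; rewrite /= /mrestr /mzero (disjoints_subset _ _).2 ?measure0.
rewrite integral_measure_zero add0e; apply: eq_measure_integral => B _ BA.
by rewrite /= /mrestr setIidl.
Qed.

Section simple_rounding.
Import HBNNSimple.

(** The positive and negative parts of the identity are approximated from below by simple functions.
    One of the two vanishes at any x, so [r n x] lies between 0 and x; the resulting domination
    makes the mean-square rounding error of a square-integrable variable tend to 0. *)
Lemma simple_rounding (R : realType) :
  exists r : nat -> R -> R,
    [/\ forall n, measurable_fun setT (r n), forall n, finite_set (range (r n)),
        forall n x, `|x - r n x| <= `|x| & forall x, r n x @[n --> \oo] --> x].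
Proof.
pose f := @EFin R.
have mf : measurable_fun setT f by exact/measurable_EFinP.
have mp := measurable_funepos mf; have mn := measurable_funeneg mf.
pose p n := nnsfun_approx measurableT mp n.
pose q n := nnsfun_approx measurableT mn n.
have pE x : (f^\+ x = (Order.max x 0)%:E)%E.
  by rewrite funeposE EFin_max.
have qE x : (f^\- x = (Order.max (- x) 0)%:E)%E.
  by rewrite funenegE EFin_max.
have ple n x : 0 <= p n x <= Order.max x 0.
  rewrite fun_ge0/= -lee_fin -pE /p nnsfun_approxE; exact: le_approx.
have qle n x : 0 <= q n x <= Order.max (- x) 0.
  rewrite fun_ge0/= -lee_fin -qE /q nnsfun_approxE; exact: le_approx.
exists (fun n x => p n x - q n x); split.
- by move=> n; exact: measurable_funB.
- move=> n.
  have pq : finite_set ((fun z => z.1 - z.2) @` (range (p n) `*` range (q n))).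
    by apply: finite_image; apply: finite_setX.
  apply: sub_finite_set pq => _ [x _ <-].
  by exists (p n x, q n x).
- move=> n x; move: (ple n x) (qle n x).
  have /orP[x0|x0] := le_total 0 x.
    rewrite max_l// max_r ?oppr_le0// => /andP[? ?] /andP[? ?].
    by rewrite ger0_norm ?ger0_norm//; lra.
  rewrite max_r// max_l ?oppr_ge0// => /andP[? ?] /andP[? ?].
  by rewrite ler0_norm ?ler0_norm//; lra.
- move=> x.
  have cp : p n x @[n --> \oo] --> Order.max x 0.
    have := @cvg_nnsfun_approx _ _ _ _ measurableT _ mp (fun _ _ => funepos_ge0 _ _) x I.
    by rewrite pE => /fine_cvgP[].
  have cq : q n x @[n --> \oo] --> Order.max (- x) 0.
    have := @cvg_nnsfun_approx _ _ _ _ measurableT _ mn (fun _ _ => funeneg_ge0 _ _) x I.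
    by rewrite qE => /fine_cvgP[].
  rewrite [X in _ --> X](_ : x = Order.max x 0 - Order.max (- x) 0).
    exact: (cvgB cp cq).
  have /orP[x0|x0] := le_total 0 x.
    by rewrite max_l// max_r ?oppr_le0//; lra.
  by rewrite max_r// max_l ?oppr_ge0//; lra.
Qed.

End simple_rounding.

(** Read as a measurable map into the Giry space of probability measures, [m] can be mixed against
    [P]. The mixture is the law of [X], by the hypothesis on Borel sets, and integration against a
    mixture is an iterated integral. *)
Lemma cond_law_integral (R : realType) (d : measure_display)
    (Omega : measurableType d) (P : probability Omega R) (X : Omega -> R)
    (m : Omega -> P2 R) (h : R -> \bar R) :
  measurable_fun setT X ->
  (forall B : set R, measurable B -> measurable_fun setT (fun w => m w B)) ->
  (forall B : set R, measurable B -> \int[P]_w m w B = P (X @^-1` B))%E ->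
  measurable_fun setT h -> (forall x, 0 <= h x)%E ->
  measurable_fun setT (fun w => \int[m w]_x h x)%E /\
  (\int[P]_w \int[m w]_x h x = \int[P]_w h (X w))%E.
Proof.
move=> mX mm PX mh h0.
pose k (w : Omega) : giry R R := (m w : probability R R).
have mk : measurable_fun setT k.
  exact: measurable_giry_codensity.
have mint := measurable_giry_int mh h0.
split; first exact: (measurableT_comp mint mk).
have := giry_int_bind (P : probability Omega R) mk mh h0.
rewrite {2 3}/giry_int => <-.
have [Q [QE Qint _]] := pushforward_probability P mX.
rewrite -Qint// /giry_int; apply: eq_measure_integral => A mA _.
apply: esym; etransitivity; first exact: QE.
rewrite -PX//; apply: esym.
have := giry_int_map mk (P : probability Omega R) (measurable_giry_ev mA)
  (fun mu => measure_ge0 mu A).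
exact.
Qed.

(** * Finite partitions and averages *)

(** Factoring the rounding through a finite type lets a rounded law be described by the masses of
    the fibres of [j], placed at the points [x i]. *)
Lemma finite_range_factor (R : realType) (r : R -> R) :
  measurable_fun setT r -> finite_set (range r) ->
  exists (I : finType) (j : R -> I) (x : I -> R),
    (forall y, r y = x (j y)) /\ forall i, measurable (j @^-1` [set i]).
Proof.
move=> mr /finite_seqP[s rs].
have inS y : r y \in s.
  by have : range r (r y) by []; rewrite rs.
exists (seq_sub s), (fun y => SeqSub (inS y)), (fun i => ssval i); split => // i.
rewrite [X in measurable X](_ : _ = r @^-1` [set ssval i]).
  by rewrite -[X in measurable X]setTI; exact: mr.
by apply/seteqP; split => y /= => [<-//|ry]; exact: val_inj.
Qed.

Lemma bigsetU_fibres (T : Type) (I : finType) (j : T -> I) :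
  \big[setU/set0]_(i <- index_enum I) (j @^-1` [set i]) = setT.
Proof.
rewrite -bigcup_seq; apply/seteqP; split => // t _.
by exists (j t) => //=; exact: mem_index_enum.
Qed.

Lemma trivIset_fibres (T : Type) (I : finType) (j : T -> I) (D : set I) (A : set T) :
  trivIset D (fun i => A `&` j @^-1` [set i]).
Proof.
by apply/trivIsetP => i k _ _ ik; apply/seteqP; split => // t [[_ /= ti] [_ /= tk]];
  move: ik; rewrite -ti -tk eqxx.
Qed.

Lemma Rintegral_fibres (R : realType) (d : measure_display)
    (T : measurableType d) (mu : {measure set T -> \bar R}) (I : finType)
    (j : T -> I) (f : T -> R) :
  (forall i, measurable (j @^-1` [set i])) ->
  mu.-integrable setT (EFin \o f) ->
  \int[mu]_x f x = \sum_i \int[mu]_(x in j @^-1` [set i]) f x.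
Proof.
move=> mj fi; rewrite /Rintegral.
have fiS i : mu.-integrable (j @^-1` [set i]) (EFin \o f).
  exact: integrableS fi.
rewrite -(bigsetU_fibres j) integral_bigsetU_EFin//.
- rewrite -sum_fine//= => i _; exact: integrable_fin_num.
- exact: index_enum_uniq.
- apply/trivIsetP => i k _ _ ik; apply/seteqP; split => // t [/= ti tk].
  by move: ik; rewrite -ti -tk eqxx.
- by rewrite bigsetU_fibres; exact: (measurable_int mu).
Qed.

Lemma measure_fibres (R : realType) (d : measure_display) (T : measurableType d)
    (mu : {measure set T -> \bar R}) (I : finType) (j : T -> I) (A : set T) :
  (forall i, measurable (j @^-1` [set i])) -> measurable A ->
  (mu A = \sum_i mu (A `&` j @^-1` [set i]))%E.
Proof.
move=> mj mA; rewrite (bigfs _ (index_enum_uniq I))//; last first.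
  by move=> i _; rewrite mem_index_enum.
rewrite [X in (_ = \sum_(i \in X) _)%E](_ : _ = [set` index_enum I]); last first.
  by apply/seteqP; split => i //= _; exact: mem_index_enum.
rewrite -measure_fin_bigcup//.
- rewrite -setI_bigcupr bigcup_seq bigsetU_fibres setIT//.
- exact: trivIset_fibres.
- by move=> i _; exact: measurableI.
Qed.

Lemma ae_le_Rintegral (R : realType) (d : measure_display)
    (T : measurableType d) (mu : {measure set T -> \bar R}) (D : set T)
    (f g : T -> R) :
  measurable D -> mu.-integrable D (EFin \o f) -> mu.-integrable D (EFin \o g) ->
  {ae mu, forall x, D x -> f x <= g x} ->
  \int[mu]_(x in D) f x <= \int[mu]_(x in D) g x.
Proof.
move=> mD fi gi fg; rewrite -subr_ge0 -RintegralB//.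
have mf : measurable_fun D f by exact/measurable_EFinP/(measurable_int mu).
have mg : measurable_fun D g by exact/measurable_EFinP/(measurable_int mu).
(* Almost everywhere on [D] the difference equals its absolute value, whose integral is
   nonnegative. *)
rewrite /Rintegral (@ae_eq_integral _ _ _ mu D (fun x => (`|g x - f x|)%:E))//.
- by rewrite fine_ge0// integral_ge0.
- by apply/measurable_EFinP; exact: measurable_funB.
- by apply/measurable_EFinP; apply: measurableT_comp => //; exact: measurable_funB.
- by apply: filterS fg => x /[apply] fgx; rewrite ger0_norm// subr_ge0.
Qed.

Lemma integrable_mul_sqr (R : realType) (d : measure_display)
    (T : measurableType d) (mu : {measure set T -> \bar R}) (D : set T)
    (f g : T -> R) :
  measurable D -> measurable_fun D f -> measurable_fun D g ->
  mu.-integrable D (fun x => ((f x) ^+ 2)%:E) ->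
  mu.-integrable D (fun x => ((g x) ^+ 2)%:E) ->
  mu.-integrable D (fun x => (f x * g x)%:E).
Proof.
move=> mD mf mg fi gi.
have := integrableD mD fi gi; apply: le_integrable => //.
  by apply/measurable_EFinP; exact: measurable_funM.
move=> x _; rewrite -EFinD !abse_EFin lee_fin normrM.
rewrite [leRHS]ger0_norm ?addr_ge0 ?sqr_ge0//.
rewrite -(real_normK (num_real (f x))) -(real_normK (num_real (g x))).
by move: (sqr_ge0 (`|f x| - `|g x|)) (sqr_ge0 (`|f x| + `|g x|)); nra.
Qed.

Lemma integrable_of_sqr (R : realType) (d : measure_display)
    (T : measurableType d) (mu : {measure set T -> \bar R}) (D : set T)
    (f : T -> R) :
  measurable D -> (mu D < +oo)%E -> measurable_fun D f ->
  mu.-integrable D (fun x => ((f x) ^+ 2)%:E) -> mu.-integrable D (EFin \o f).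
Proof.
move=> mD fin mf fi.
have i1 : mu.-integrable D (fun _ => ((1 : R) ^+ 2)%:E).
  rewrite expr1n; apply/integrableP; split; first exact: measurable_cst.
  by under eq_integral do rewrite abse_EFin normr1; rewrite integral_cst// mul1e.
have := integrable_mul_sqr mD mf (measurable_cst (1 : R)) fi i1.
by apply: eq_integrable => // x _; rewrite /= mulr1.
Qed.

(** The class of [t] records, for every [i], which interval of length 1/N < e contains [f i t].
    There are N + 1 intervals because the value 1 falls in the one numbered N. *)
Lemma finite_oscillation_partition (R : realType) (d : measure_display)
    (T : measurableType d) (I : finType) (f : I -> T -> R) (e : R) :
  0 < e -> (forall i, measurable_fun setT (f i)) ->
  (forall i t, 0 <= f i t <= 1) ->
  exists (K : finType) (k : T -> K),
    (forall c, measurable (k @^-1` [set c])) /\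
    forall t u i, k t = k u -> `|f i t - f i u| <= e.
Proof.
move=> e0 mf f01.
pose N := (Num.truncn e^-1).+1.
have Ne : e^-1 < N%:R by exact: truncnS_gt.
have N0 : 0 < N%:R :> R by rewrite ltr0n.
have N1 : N%:R^-1 < e by rewrite invf_plt ?posrE.
pose c i t := Num.truncn (N%:R * f i t).
have cle i t : (c i t < N.+1)%N.
  rewrite ltnS /c -(@ler_nat R); apply: le_trans (_ : N%:R * f i t <= _).
    by have /andP[] := truncn_itv (mulr_ge0 (ltW N0) (andP (f01 i t)).1).
  by have /andP[_ f1] := f01 i t; rewrite ler_piMr.
have cE i t : (c i t)%:R <= N%:R * f i t < (c i t).+1%:R.
  exact: truncn_itv (mulr_ge0 (ltW N0) (andP (f01 i t)).1).
exists {ffun I -> 'I_N.+1}, (fun t => [ffun i => Ordinal (cle i t)]); split.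
- move=> g; rewrite [X in measurable X](_ : _ =
    \bigcap_(i in [set: I]) [set t | (g i)%:R <= N%:R * f i t < (g i).+1%:R]).
    apply: fin_bigcap_measurable => // i _.
    rewrite [X in measurable X](_ : _ = (fun t => N%:R * f i t) @^-1`
      `[(g i)%:R, (g i).+1%:R[%classic); last first.
      by apply/seteqP; split => t /=; rewrite in_itv.
    rewrite -[X in measurable X]setTI.
    have mfi : measurable_fun setT (fun t => N%:R * f i t) by exact: measurable_funM.
    exact: mfi.
  apply/seteqP; split => t /=.
    by move=> <- i _ /=; rewrite ffunE; exact: cE.
  move=> gt; apply/ffunP => i; rewrite ffunE; apply: val_inj => /=.
  have /andP[g1 g2] := gt i Logic.I; have /andP[c1 c2] := cE i t.
  apply/eqP; rewrite eqn_leq -ltnS -[X in _ && X]ltnS -!(@ltr_nat R).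
  by rewrite (le_lt_trans c1 g2) (le_lt_trans g1 c2).
- move=> t u i /ffunP /(_ i); rewrite !ffunE => -[tu].
  have /andP[t1 t2] := cE i t; have /andP[u1 u2] := cE i u.
  rewrite tu in t1 t2; rewrite -natr1 in t2; rewrite -natr1 in u2.
  have : N%:R * `|f i t - f i u| <= 1.
    by rewrite -{1}(gtr0_norm N0) -normrM mulrBr ler_norml; apply/andP; split; lra.
  by rewrite mulrC -ler_pdivlMr// mul1r => /le_trans; apply; exact: ltW.
Qed.

(** The constant [f w] is its own average over [A], so the difference is the average of f w - f
    v. *)
Lemma average_oscillation (R : realType) (d : measure_display)
    (T : measurableType d) (P : probability T R) (A : set T) (f : T -> R)
    (e : R) (w : T) :
  measurable A -> 0 < fine (P A) -> P.-integrable A (EFin \o f) ->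
  (forall v, A v -> `|f w - f v| <= e) ->
  `|f w - (fine (P A))^-1 * \int[P]_(v in A) f v| <= e.
Proof.
move=> mA pi0 fi osc.
have PAy : (P A < +oo)%E by rewrite -ge0_fin_numE// fin_num_measure.
have ci (c : R) : P.-integrable A (EFin \o (fun=> c)).
  exact: finite_measure_integrable_cst.
have wE : f w = (fine (P A))^-1 * \int[P]_(v in A) f w.
  by rewrite Rintegral_cst// mulrCA mulVf ?mulr1// gt_eqF.
rewrite {1}wE -mulrBr -RintegralB// normrM gtr0_norm ?invr_gt0//.
rewrite mulrC ler_pdivrMr//.
have bi : P.-integrable A (EFin \o (fun v => f w - f v)).
  by have := integrableB mA (ci (f w)) fi; apply: eq_integrable.
apply: le_trans (le_normr_Rintegral mA bi) _.
rewrite -Rintegral_cst//; apply: le_Rintegral => //.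
exact: (integrable_norm bi).
Qed.

Lemma measure_rounding (R : realType) (mu : {measure set R -> \bar R})
    (I : finType) (j : R -> I) (x : I -> R) (A : set R) :
  (forall i, measurable (j @^-1` [set i])) ->
  measurable ((x \o j) @^-1` A) ->
  (mu ((x \o j) @^-1` A) = \sum_i mu (j @^-1` [set i]) * \d_(x i) A)%E.
Proof.
move=> mj mA; rewrite (measure_fibres mu mj mA); apply: eq_bigr => i _.
rewrite diracE; have [xA|xA] := boolP (x i \in A).
  rewrite mule1; congr (mu _); apply/seteqP; split => [t []//|t /= ti].
  by split => //=; rewrite ti; exact: set_mem.
rewrite mule0 [X in mu X](_ : _ = set0) ?measure0//.
apply/seteqP; split => // t /= [At ti]; rewrite ti in At.
by move: xA; rewrite notin_setE; exact.
Qed.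

(** * Monotonicity conditionally on a sub-sigma-algebra *)

Lemma P2_rounding_integrable (R : realType) (m : P2 R) (r : R -> R) :
  measurable_fun setT r -> (forall t, `|t - r t| <= `|t|) ->
  (\int[m]_t (`|t - r t| ^+ 2)%:E < +oo)%E.
Proof.
move=> mr rt; apply: le_lt_trans (P2_moment m).
apply: ge0_le_integral => //.
- apply/measurable_EFinP; apply: measurable_funX; apply: measurableT_comp => //.
  exact: measurable_funB.
- by apply/measurable_EFinP; exact: exprn_measurable.
- move=> t _; rewrite lee_fin -[leRHS](real_normK (num_real t)).
  by rewrite lerXn2r ?nnegrE ?normr_ge0.
Qed.

(** The weight [k] is free: in the final estimate it makes the term in b^2 small, while a^2 / k
    stays small because the rounding error is taken of order k^2. *)
Lemma young_le (R : realType) (a b k : R) : 0 < k -> a * b <= k * b ^+ 2 + k^-1 * a ^+ 2.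
Proof.
move=> k0; have k1 : 0 < k^-1 by rewrite invr_gt0.
have kk : k * k^-1 = 1 by rewrite divff// gt_eqF.
have h := sqr_ge0 (k * b - a).
rewrite -(ler_pM2l k0) mulrDr (mulrA k k^-1) kk mul1r.
have h2 := sqr_ge0 (k * b); have h3 := sqr_ge0 a.
nra.
Qed.

(* [m w] is compared with the law of [X] given [A] along the chain
   [m w], [(x \o j)_# (m w)], [(x \o j)_# mu], [mu]. *)
Lemma W2_lipschitz_cond_law (R : realType) (d : measure_display)
    (Omega : measurableType d) (P Q : probability Omega R) (A : set Omega)
    (X : Omega -> R) (m : Omega -> P2 R) (mu : P2 R) (I : finType) (j : R -> I)
    (x : I -> R) (phi : P2 R -> R) (C e k D : R) (w : Omega) :
  measurable A -> 0 < fine (P A) ->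
  (forall B, Q B = (fine (P A))^-1%:E * P (B `&` A))%E ->
  (forall h : Omega -> \bar R, measurable_fun setT h -> (forall y, (0 <= h y)%E) ->
      (\int[Q]_y h y = (fine (P A))^-1%:E * \int[P]_(x in A) h x)%E) ->
  measurable_fun setT X ->
  P.-integrable setT (fun w => ((X w) ^+ 2)%:E) ->
  (forall B, measurable B -> measurable_fun setT (fun w => m w B)) ->
  (forall B, measurable B -> \int[P]_(w in A) m w B = P (A `&` X @^-1` B))%E ->
  (forall B, measurable B -> mu B = Q (X @^-1` B)) ->
  (forall i, measurable (j @^-1` [set i])) -> measurable_fun setT (x \o j) ->
  (forall t, `|t - x (j t)| <= `|t|) ->
  (forall v i, A v ->
     `|fine (m w (j @^-1` [set i])) - fine (m v (j @^-1` [set i]))| <= e) ->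
  0 <= C -> (forall m1 m2, `|phi m1 - phi m2| <= C * W2 m1 m2) ->
  0 <= e -> 0 < k -> 0 <= D ->
  `|phi (m w) - phi mu| * D <= C * (3 * k * D ^+ 2 + k^-1 *
    (\int[m w]_t (`|t - x (j t)| ^+ 2) +
     e * (\sum_i \sum_l `|x i - x l| ^+ 2) +
     (fine (P A))^-1 * \int[P]_(v in A) (`|X v - x (j (X v))| ^+ 2))).
Proof.
move=> mA pA0 QE Qint mX X2 mm mAX muE mj mr rt osc C0 phiC e0 k0 D0.
have mX' (B : set R) : measurable B -> measurable (X @^-1` B).
  by move=> mB; rewrite -[X in measurable X]setTI; exact: mX.
have mrX : measurable_fun setT (x \o j \o X) by exact: measurableT_comp.
have mr' (B : set R) : measurable B -> measurable ((x \o j) @^-1` B).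
  by move=> mB; rewrite -[X in measurable X]setTI; exact: mr.
have mdX : measurable_fun setT (fun v => `|X v - x (j (X v))| ^+ 2).
  by apply: measurable_funX; apply: measurableT_comp => //; exact: measurable_funB.
have dX2 : P.-integrable setT (fun v => (`|X v - x (j (X v))| ^+ 2)%:E).
  apply: le_integrable X2 => //; first exact/measurable_EFinP.
  move=> v _; rewrite !abse_EFin lee_fin !normrX normr_id.
  by rewrite lerXn2r ?nnegrE ?normr_ge0.
(* Rounding at most doubles a value, whence the factor 4 in the comparisons of second moments
   below. *)
have rt2 y : `|x (j y)| <= 2 * `|y|.
  by have := rt y; have := ler_normB y (y - x (j y)); rewrite opprB addrCA subrr addr0; lra.
have dmw := P2_rounding_integrable (m w) mr rt.
have m2 : (\int[m w]_t ((x (j t)) ^+ 2)%:E < +oo)%E.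
  apply: (@le_lt_trans _ _ (\int[m w]_t (4%:E * (t ^+ 2)%:E))%E).
    apply: ge0_le_integral => //.
    - by move=> t _; rewrite lee_fin sqr_ge0.
    - by apply/measurable_EFinP; exact: measurable_funX mr.
    - by apply: measurable_funeM; apply/measurable_EFinP; exact: exprn_measurable.
    - move=> t _; rewrite -EFinM lee_fin -(real_normK (num_real t)).
      rewrite -(real_normK (num_real (x _))).
      by have := rt2 t; have := normr_ge0 (x (j t)); nra.
  rewrite ge0_integralZl//.
  - by rewrite lte_mul_pinfty// P2_moment.
  - by apply/measurable_EFinP; exact: exprn_measurable.
  - by move=> t _; rewrite lee_fin sqr_ge0.
have [rm rmE] := law_in_P2 mr m2.
have rX2 : (\int[Q]_v ((x (j (X v))) ^+ 2)%:E < +oo)%E.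
  rewrite Qint; last 2 first.
  - by apply/measurable_EFinP; exact: measurable_funX mrX.
  - by move=> y; rewrite lee_fin sqr_ge0.
  rewrite lte_mul_pinfty ?lee_fin ?invr_ge0 ?ltW//.
  have : (\int[P]_(v in A) (4%:E * ((X v) ^+ 2)%:E) < +oo)%E.
    have := integrableZl mA 4 (integrableS measurableT mA (@subsetT _ _) X2).
    move=> /integrableP[_]; under eq_integral do
      rewrite gee0_abs ?mule_ge0 ?lee_fin ?sqr_ge0//.
    done.
  apply: le_lt_trans; apply: ge0_le_integral => //.
  - by move=> t _; rewrite lee_fin sqr_ge0.
  - by apply/measurable_EFinP/measurable_funTS; exact: measurable_funX mrX.
  - apply: measurable_funeM; apply/measurable_EFinP/measurable_funTS.
    exact: measurable_funX.
  - move=> t _; rewrite -EFinM lee_fin -(real_normK (num_real (X t))).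
    rewrite -(real_normK (num_real (x _))).
    by have := rt2 (X t); have := normr_ge0 (x (j (X t))); nra.
have [rmu rmuE] := law_in_P2 mrX rX2.
have W1 : W2 (m w) rm ^+ 2 <= \int[m w]_t (`|t - x (j t)| ^+ 2).
  apply: (@sqr_W2_pushforward _ _ _ (m w) id (x \o j)) => //.
  rewrite /Rintegral fineK// ge0_fin_numE//.
  by apply: integral_ge0 => t _; rewrite lee_fin sqr_ge0.
have W3 : W2 rmu mu ^+ 2 <=
    (fine (P A))^-1 * \int[P]_(v in A) (`|X v - x (j (X v))| ^+ 2).
  apply: (@sqr_W2_pushforward _ _ _ Q (x \o j \o X) X) => //.
  under eq_integral do rewrite distrC.
  rewrite Qint; last 2 first.
  - exact/measurable_EFinP.
  - by move=> y; rewrite lee_fin sqr_ge0.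
  rewrite EFinM /Rintegral fineK//.
  apply: integrable_fin_num => //; exact: integrableS dX2.
pose p i := fine (m w (j @^-1` [set i])).
pose q i := fine (Q (X @^-1` (j @^-1` [set i]))).
have pfin i : m w (j @^-1` [set i]) \is a fin_num by exact: fin_num_measure.
have qfin i : Q (X @^-1` (j @^-1` [set i])) \is a fin_num.
  by apply: fin_num_measure; exact: mX'.
have rmE' B : measurable B -> (rm B = \sum_i (p i)%:E * \d_(x i) B)%E.
  move=> mB; rewrite rmE measure_rounding//; last exact: mr'.
  by apply: eq_bigr => i _; rewrite fineK.
have [Q' [Q'E _ _]] := pushforward_probability Q mX.
have rmuE' B : measurable B -> (rmu B = \sum_i (q i)%:E * \d_(x i) B)%E.
  move=> mB; rewrite rmuE comp_preimage -Q'E measure_rounding//; last exact: mr'.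
  by apply: eq_bigr => i _; rewrite /q fineK//; congr (_ * _)%E; exact: Q'E.
have W2' : W2 rm rmu ^+ 2 <= e * (\sum_i \sum_l `|x i - x l| ^+ 2).
  apply: (@sqr_W2_discrete _ _ x p q) => //.
  - by move=> i; rewrite fine_ge0.
  - by move=> i; rewrite fine_ge0.
  - apply: EFin_inj; rewrite -sumEFin -(probability_setT rm) rmE'//.
    by apply: eq_bigr => i _; rewrite diracT mule1.
  - apply: EFin_inj; rewrite -sumEFin -(probability_setT rmu) rmuE'//.
    by apply: eq_bigr => i _; rewrite diracT mule1.
  - move=> i; rewrite /p.
    (* By the conditional-law identity on [A], the mass of a fibre under the law of [X] given [A] is
       the average over [A] of its masses under the laws [m v], each within [e] of its mass under
       [m w]. *)
    have -> : q i = (fine (P A))^-1 *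
        \int[P]_(v in A) fine (m v (j @^-1` [set i])).
      rewrite /q QE setIC -mAX// fineM//; last first.
        rewrite mAX//; apply: fin_num_measure; apply: measurableI => //.
        exact: mX'.
      congr (_ * fine _); apply: eq_integral => v _.
      by rewrite fineK// fin_num_measure.
    apply: (@average_oscillation _ _ _ _ _
      (fun v => fine (m v (j @^-1` [set i])))) => //.
    + have mmi := mm _ (mj i).
      apply: (@le_integrable _ _ _ P A mA _ (EFin \o (fun=> 1))).
      * apply/measurable_EFinP/measurable_funTS.
        by apply: measurableT_comp => //; exact: fine_measurable.
      * move=> v _ /=; rewrite lee_fin normr1 ger0_norm ?fine_ge0//.
        by rewrite -lee_fin fineK ?fin_num_measure ?probability_le1.
      * by apply: finite_measure_integrable_cst; exact: mA.
    + by move=> v Av; exact: osc.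
have tri : `|phi (m w) - phi mu| <=
    C * (W2 (m w) rm + W2 rm rmu + W2 rmu mu).
  have -> : phi (m w) - phi mu =
    (phi (m w) - phi rm) + (phi rm - phi rmu) + (phi rmu - phi mu) by ring.
  rewrite !mulrDr; apply: le_trans (ler_normD _ _) _.
  by rewrite lerD// (le_trans (ler_normD _ _))// lerD.
apply: (le_trans (ler_wpM2r D0 tri)); rewrite -[leLHS]mulrA ler_wpM2l//.
have k1 : 0 <= k^-1 by rewrite invr_ge0 ltW.
(* One use of the weighted inequality for each of the three links of the chain, whence the
   coefficient 3 k. *)
have y1 := young_le (W2 (m w) rm) D k0.
have y2 := young_le (W2 rm rmu) D k0.
have y3 := young_le (W2 rmu mu) D k0.
have z1 := ler_wpM2l k1 W1; have z2 := ler_wpM2l k1 W2'.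
have z3 := ler_wpM2l k1 W3.
rewrite !mulrDr !mulrDl; lra.
Qed.

Lemma lipschitz_measurable (R : realType) (f : R -> R) (C : R) :
  (forall x y, `|f x - f y| <= C * `|x - y|) -> measurable_fun setT f.
Proof.
move=> fC; apply: continuous_measurable_fun => x.
apply/cvgrPdist_lt => e e0.
have c0 : 0 < `|C| + 1 by rewrite ltr_wpDl.
near=> y; apply: le_lt_trans (fC _ _) _.
apply: (@le_lt_trans _ _ ((`|C| + 1) * `|x - y|)).
  by rewrite ler_wpM2r// (le_trans (ler_norm _))// lerDl.
rewrite mulrC -ltr_pdivlMr//.
by near: y; apply: (@cvgr_dist_lt _ R^o) => //; rewrite divr_gt0.
Unshelve. all: by end_near. Qed.

Lemma lipschitz_sqr_integrable (R : realType) (d : measure_display)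
    (T : measurableType d) (P : probability T R) (f : R -> R) (C : R)
    (X : T -> R) :
  (forall x y, `|f x - f y| <= C * `|x - y|) -> measurable_fun setT X ->
  P.-integrable setT (fun w => ((X w) ^+ 2)%:E) ->
  P.-integrable setT (fun w => ((f (X w)) ^+ 2)%:E).
Proof.
move=> fC mX X2.
have mfX : measurable_fun setT (f \o X).
  by apply: measurableT_comp => //; exact: lipschitz_measurable fC.
have i1 : P.-integrable setT (EFin \o (fun=> 2 * f 0 ^+ 2)).
  exact: finite_measure_integrable_cst.
have i2 := integrableZl measurableT (2 * C ^+ 2) X2.
apply: le_integrable (integrableD measurableT i1 i2) => //.
  by apply/measurable_EFinP; exact: measurable_funX mfX.
move=> w _ /=; rewrite lee_fin [leLHS]ger0_norm ?sqr_ge0//.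
apply: le_trans (ler_norm _).
have := fC (X w) 0; rewrite subr0 => h.
have : `|f (X w) - f 0| ^+ 2 <= C ^+ 2 * X w ^+ 2.
  rewrite -(real_normK (num_real (X w))) -exprMn.
  by rewrite lerXn2r ?nnegrE// (le_trans _ h).
rewrite real_normK ?num_real// => {}h.
(* This square is exactly the gap in f(X)^2 <= 2 f(0)^2 + 2 (f(X) - f(0))^2. *)
have := sqr_ge0 (f (X w) - 2 * f 0); nra.
Qed.

(** Extends the formula from nonnegative to integrable functions through positive and negative
    parts, both of finite integral over [A]. *)
Lemma conditioned_Rintegral (R : realType) (d : measure_display)
    (T : measurableType d) (P Q : probability T R) (A : set T) (c : R)
    (h : T -> R) :
  measurable A -> 0 <= c ->
  (forall h : T -> \bar R, measurable_fun setT h -> (forall y, (0 <= h y)%E) ->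
      (\int[Q]_y h y = c%:E * \int[P]_(x in A) h x)%E) ->
  P.-integrable setT (EFin \o h) ->
  Q.-integrable setT (EFin \o h) /\
  \int[Q]_y h y = c * \int[P]_(y in A) h y.
Proof.
move=> mA c0 Qint hi; have mh := measurable_int P hi.
have hA : P.-integrable A (EFin \o h) by exact: integrableS hi.
have hp := integrable_pos_fin_num mA hA; have hn := integrable_neg_fin_num mA hA.
split.
  apply/integrableP; split => //; rewrite Qint//; last first.
    exact: measurableT_comp mh.
  rewrite lte_mul_pinfty ?lee_fin//.
  by move/integrableP : hA => [].
rewrite /Rintegral integralE [in RHS]integralE.
rewrite !Qint//; [|exact: measurable_funeneg|exact: measurable_funepos].
have hp' : (\int[P]_(x in A) (fun x => (h x)%:E)^\+ x)%E \is a fin_num by [].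
have hn' : (\int[P]_(x in A) (fun x => (h x)%:E)^\- x)%E \is a fin_num by [].
by rewrite -(fineK hp') -(fineK hn') -!EFinM -!EFinB /= mulrBr.
Qed.

(** The cost of rounding the random law [m w], averaged over w, is the cost of rounding [X]. A
    single mean-square error thus controls both the rounding of the conditional laws and that of the
    laws given the events of a partition. *)
Lemma cond_law_rounding_error (R : realType) (d : measure_display)
    (Omega : measurableType d) (P : probability Omega R) (X : Omega -> R)
    (m : Omega -> P2 R) (r : R -> R) :
  measurable_fun setT X ->
  P.-integrable setT (fun w => ((X w) ^+ 2)%:E) ->
  (forall B : set R, measurable B -> measurable_fun setT (fun w => m w B)) ->
  (forall B : set R, measurable B -> \int[P]_w m w B = P (X @^-1` B))%E ->
  measurable_fun setT r -> (forall t, `|t - r t| <= `|t|) ->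
  [/\ P.-integrable setT (fun w => (`|X w - r (X w)| ^+ 2)%:E),
      P.-integrable setT (fun w => (\int[m w]_t (`|t - r t| ^+ 2))%:E)
    & \int[P]_w (\int[m w]_t (`|t - r t| ^+ 2)) =
      \int[P]_w (`|X w - r (X w)| ^+ 2)].
Proof.
move=> mX X2 mm mP mr rt.
have md : measurable_fun setT (fun t : R => `|t - r t| ^+ 2).
  by apply: measurable_funX; apply: measurableT_comp => //; exact: measurable_funB.
have mdX : measurable_fun setT (fun w => `|X w - r (X w)| ^+ 2).
  exact: (measurableT_comp md mX).
have dX2 : P.-integrable setT (fun v => (`|X v - r (X v)| ^+ 2)%:E).
  apply: le_integrable X2 => //; first exact/measurable_EFinP.
  move=> v _; rewrite !abse_EFin lee_fin !normrX normr_id.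
  by rewrite lerXn2r ?nnegrE.
have h0 t : (0 <= (`|t - r t| ^+ 2)%:E)%E by rewrite lee_fin sqr_ge0.
have [mint intE] := cond_law_integral mX mm mP
  ((measurable_EFinP _ _).2 md) h0.
have intfin w : (\int[m w]_t (`|t - r t| ^+ 2)%:E)%E \is a fin_num.
  rewrite ge0_fin_numE ?P2_rounding_integrable//.
  by apply: integral_ge0 => t _; exact: h0.
have fint : P.-integrable setT
    (fun w => (\int[m w]_t (`|t - r t| ^+ 2)%:E)%E).
  apply/integrableP; split => //.
  under eq_integral do rewrite gee0_abs ?integral_ge0//.
  by rewrite intE; have /integrable_fin_num := dX2; rewrite fin_numElt => /(_ measurableT)/andP[].
have HE w : (\int[m w]_t (`|t - r t| ^+ 2))%:E =
    (\int[m w]_t (`|t - r t| ^+ 2)%:E)%E.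
  by apply: fineK; exact: intfin.
split => //; first by rewrite (funext HE).
by rewrite {1}/Rintegral; under eq_integral do rewrite HE; rewrite intE.
Qed.

(** The joint law of (X, Y) under [Q] couples [mu] and [nu], so displacement monotonicity applies to
    it; [c] converts integrals under [Q] into integrals over [A]. As [mu] and [nu] are
    deterministic, the integrand is measurable by Lipschitz continuity in the first variable. *)
Lemma conditioned_monotone (R : realType) (d : measure_display)
    (Omega : measurableType d) (P Q : probability Omega R) (A : set Omega)
    (c C : R) (X Y : Omega -> R) (mu nu : P2 R) (gx : R -> P2 R -> R) :
  measurable A -> 0 < c ->
  (forall h : Omega -> \bar R, measurable_fun setT h -> (forall y, (0 <= h y)%E) ->
      (\int[Q]_y h y = c%:E * \int[P]_(x in A) h x)%E) ->
  measurable_fun setT X -> measurable_fun setT Y ->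
  P.-integrable setT (fun w => ((X w) ^+ 2)%:E) ->
  P.-integrable setT (fun w => ((Y w) ^+ 2)%:E) ->
  (forall B, measurable B -> mu B = Q (X @^-1` B)) ->
  (forall B, measurable B -> nu B = Q (Y @^-1` B)) ->
  (forall x x' m, `|gx x m - gx x' m| <= C * `|x - x'|) ->
  (forall (m m' : P2 R) (gamma : probability (R * R)%type R),
     (\int[gamma]_p (p.1 ^+ 2 + p.2 ^+ 2)%:E < +oo)%E ->
     coupling m m' gamma ->
     (0 <= \int[gamma]_p ((gx p.1 m - gx p.2 m') * (p.1 - p.2))%:E)%E) ->
  P.-integrable setT
    (EFin \o (fun w => (gx (X w) mu - gx (Y w) nu) * (Y w - X w))) /\
  \int[P]_(w in A) ((gx (X w) mu - gx (Y w) nu) * (Y w - X w)) <= 0.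
Proof.
move=> mA c0 Qint mX mY X2 Y2 muE nuE gxC mono.
have mg m : measurable_fun setT (gx ^~ m).
  exact: (lipschitz_measurable (fun x y => gxC x y m)).
have gX := lipschitz_sqr_integrable (fun x y => gxC x y mu) mX X2.
have gY := lipschitz_sqr_integrable (fun x y => gxC x y nu) mY Y2.
have mgX : measurable_fun setT (fun w => gx (X w) mu).
  exact: (measurableT_comp (mg mu) mX).
have mgY : measurable_fun setT (fun w => gx (Y w) nu).
  exact: (measurableT_comp (mg nu) mY).
pose psi (p : R * R) := (gx p.1 mu - gx p.2 nu) * (p.1 - p.2).
have mpsi : measurable_fun setT psi.
  apply: measurable_funM; last exact: measurable_funB.
  apply: measurable_funB.
    exact: (measurableT_comp (mg mu) measurable_fst).
  exact: (measurableT_comp (mg nu) measurable_snd).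
have ipsi : P.-integrable setT (EFin \o (fun w => psi (X w, Y w))).
  have i1 := integrable_mul_sqr measurableT mgX mX gX X2.
  have i2 := integrable_mul_sqr measurableT mgX mY gX Y2.
  have i3 := integrable_mul_sqr measurableT mgY mX gY X2.
  have i4 := integrable_mul_sqr measurableT mgY mY gY Y2.
  have := integrableB measurableT (integrableB measurableT i1 i2)
    (integrableB measurableT i3 i4).
  apply: eq_integrable => // w _ /=; rewrite -!EFinB; congr (_%:E).
  by rewrite /psi/=; ring.
have negE w : (gx (X w) mu - gx (Y w) nu) * (Y w - X w) = - psi (X w, Y w).
  by rewrite /psi/=; ring.
split.
  have := integrableN ipsi; apply: eq_integrable => // w _.
  by rewrite /= negE EFinN.
have -> : \int[P]_(w in A) ((gx (X w) mu - gx (Y w) nu) * (Y w - X w)) =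
    - \int[P]_(w in A) psi (X w, Y w).
  under eq_Rintegral do rewrite negE -mulN1r.
  by rewrite RintegralZl ?mulN1r//; exact: integrableS ipsi.
rewrite oppr_le0 -(pmulr_rge0 _ c0).
have [iQ <-] := conditioned_Rintegral mA (ltW c0) Qint ipsi.
have [gamma [gE g0 gint]] := pushforward_probability Q (measurable_fun_pair mX mY).
rewrite /Rintegral fine_ge0//.
have -> : (\int[Q]_w (psi (X w, Y w))%:E = \int[gamma]_p (psi p)%:E)%E.
  by rewrite gint//; exact/measurable_EFinP.
apply: mono; last by split => B mB; rewrite ?muE ?nuE// gE.
rewrite g0; last 2 first.
- apply/measurable_EFinP; apply: measurable_funD.
    exact: (measurable_funX _ measurable_fst).
  exact: (measurable_funX _ measurable_snd).
- by move=> p; rewrite lee_fin addr_ge0 ?sqr_ge0.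
rewrite Qint; last 2 first.
- apply/measurable_EFinP; apply: measurable_funD; exact: measurable_funX.
- by move=> p; rewrite lee_fin addr_ge0 ?sqr_ge0.
rewrite lte_mul_pinfty ?lee_fin ?ltW//.
have := integrableD mA (integrableS measurableT mA (@subsetT _ _) X2)
  (integrableS measurableT mA (@subsetT _ _) Y2).
move=> /integrableP[_]; under eq_integral do
  rewrite -EFinD gee0_abs ?lee_fin ?addr_ge0 ?sqr_ge0//.
done.
Qed.

Lemma sub_sigma_measurable_fun (R : realType) (d : measure_display)
    (Omega : measurableType d) (F : set (set Omega)) (f : Omega -> \bar R) :
  sigma_algebra setT F -> F `<=` measurable ->
  measurable_fun (setT : set (g_sigma_algebraType F)) f ->
  measurable_fun (setT : set Omega) f.
Proof.
move=> sF Fm mf _ B mB; apply: Fm; rewrite -(sigma_algebra_id sF).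
exact: (mf measurableT).
Qed.

(** On [A] the laws [mX w] and [mY w] are replaced by those of [X] and [Y] given [A], after which
    the integral is nonpositive. Up to the factor [C], each of the two replacements costs 3 k (Y -
    X)^2 and, divided by k, one oscillation term in [e]; hence 6 k and 2 e. [G] is an integrable
    minorant of a product that is not known to be measurable. *)
Lemma cond_law_monotone_piece (R : realType) (d : measure_display)
    (Omega : measurableType d) (P : probability Omega R) (A : set Omega)
    (X Y : Omega -> R) (mX mY : Omega -> P2 R) (gx : R -> P2 R -> R) (C : R)
    (G : Omega -> R) (I : finType) (j : R -> I) (x : I -> R) (e k : R) :
  measurable A ->
  measurable_fun setT X -> measurable_fun setT Y ->
  P.-integrable setT (fun w => ((X w) ^+ 2)%:E) ->
  P.-integrable setT (fun w => ((Y w) ^+ 2)%:E) ->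
  (forall B, measurable B -> measurable_fun setT (fun w => mX w B)) ->
  (forall B, measurable B -> measurable_fun setT (fun w => mY w B)) ->
  (forall B, measurable B -> \int[P]_w mX w B = P (X @^-1` B))%E ->
  (forall B, measurable B -> \int[P]_w mY w B = P (Y @^-1` B))%E ->
  (forall B, measurable B -> \int[P]_(w in A) mX w B = P (A `&` X @^-1` B))%E ->
  (forall B, measurable B -> \int[P]_(w in A) mY w B = P (A `&` Y @^-1` B))%E ->
  0 <= C ->
  (forall x x' m, `|gx x m - gx x' m| <= C * `|x - x'|) ->
  (forall x m m', `|gx x m - gx x m'| <= C * W2 m m') ->
  (forall (m m' : P2 R) (gamma : probability (R * R)%type R),
     (\int[gamma]_p (p.1 ^+ 2 + p.2 ^+ 2)%:E < +oo)%E ->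
     coupling m m' gamma ->
     (0 <= \int[gamma]_p ((gx p.1 m - gx p.2 m') * (p.1 - p.2))%:E)%E) ->
  P.-integrable setT (EFin \o G) ->
  {ae P, forall w, G w <= (gx (X w) (mX w) - gx (Y w) (mY w)) * (Y w - X w)} ->
  (forall i, measurable (j @^-1` [set i])) -> measurable_fun setT (x \o j) ->
  (forall t, `|t - x (j t)| <= `|t|) ->
  (forall w v i, A w -> A v ->
     `|fine (mX w (j @^-1` [set i])) - fine (mX v (j @^-1` [set i]))| <= e) ->
  (forall w v i, A w -> A v ->
     `|fine (mY w (j @^-1` [set i])) - fine (mY v (j @^-1` [set i]))| <= e) ->
  0 <= e -> 0 < k ->
  \int[P]_(w in A) G w <= \int[P]_(w in A) (C * (6 * k * (Y w - X w) ^+ 2 +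
    k^-1 * (\int[mX w]_t (`|t - x (j t)| ^+ 2) + `|X w - x (j (X w))| ^+ 2 +
            \int[mY w]_t (`|t - x (j t)| ^+ 2) + `|Y w - x (j (Y w))| ^+ 2 +
            2 * e * (\sum_i \sum_l `|x i - x l| ^+ 2)))).
Proof.
move=> mA mX' mY' X2 Y2 mmX mmY PX PY PAX PAY C0 gxC gxW mono Gi Gle mj mr rt.
move=> oscX oscY e0 k0.
have [dX HXi HXE] := cond_law_rounding_error mX' X2 mmX PX mr rt.
have [dY HYi HYE] := cond_law_rounding_error mY' Y2 mmY PY mr rt.
set S := \sum_i _.
have D2 : P.-integrable setT (fun w => ((Y w - X w) ^+ 2)%:E).
  have i1 := integrable_mul_sqr measurableT mX' mY' X2 Y2.
  have := integrableB measurableT (integrableD measurableT X2 Y2)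
    (integrableZl measurableT 2 i1).
  apply: eq_integrable => // w _ /=.
  by congr (_%:E); ring.
have ci (c : R) : P.-integrable setT (EFin \o (fun=> c)).
  exact: finite_measure_integrable_cst.
have SA (f : Omega -> R) : P.-integrable setT (EFin \o f) ->
    P.-integrable A (EFin \o f) by move=> fi; exact: integrableS fi.
(* Stated for arbitrary [aX] and [aY]: it serves both for the constant averages over [A] and for the
   rounding errors themselves. *)
have Bi (aX aY : Omega -> R) : P.-integrable setT (EFin \o aX) ->
  P.-integrable setT (EFin \o aY) ->
  P.-integrable A (EFin \o (fun w => C * (6 * k * (Y w - X w) ^+ 2 +
    k^-1 * (\int[mX w]_t (`|t - x (j t)| ^+ 2) + aX w +
            \int[mY w]_t (`|t - x (j t)| ^+ 2) + aY w + 2 * e * S)))).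
  move=> aXi aYi; apply: SA.
  have i1 := integrableD measurableT (integrableD measurableT (integrableD
    measurableT (integrableD measurableT HXi aXi) HYi) aYi) (ci (2 * e * S)).
  have i2 := integrableD measurableT (integrableZl measurableT (6 * k) D2)
    (integrableZl measurableT k^-1 i1).
  have := integrableZl measurableT C i2; apply: eq_integrable => // w _.
(* Conditioning on [A] requires positive mass; on a null set both integrals are 0. *)
have [PA0|PA0] := eqVneq (P A) 0%E.
  by rewrite /Rintegral !null_set_integral//;
    apply: (measurable_int P); [exact: Bi|exact: SA].
have pA0 : 0 < fine (P A).
  by rewrite fine_gt0// lt0e PA0 measure_ge0/= -ge0_fin_numE// fin_num_measure.
have c0 : 0 < (fine (P A))^-1 by rewrite invr_gt0.
have [Q [QE Qint]] := conditioned_probability mA PA0.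
have Q2 (Z : Omega -> R) : measurable_fun setT Z ->
    P.-integrable setT (fun w => ((Z w) ^+ 2)%:E) ->
    (\int[Q]_w ((Z w) ^+ 2)%:E < +oo)%E.
  move=> mZ Z2; have [QZ _] := conditioned_Rintegral mA (ltW c0) Qint Z2.
  exact: integrable_lty QZ.
have [mu muE] := law_in_P2 mX' (Q2 _ mX' X2).
have [nu nuE] := law_in_P2 mY' (Q2 _ mY' Y2).
have [psii psi0] := conditioned_monotone mA c0 Qint mX' mY' X2 Y2
  (fun B _ => muE B) (fun B _ => nuE B) gxC mono.
(* The pointwise estimate involves the averages of the rounding errors over [A]. They have the same
   integral over [A] as the errors themselves, and exchanging them gives an integrand that does not
   depend on [A], so that the bounds can be summed over a partition. *)
pose aX := (fine (P A))^-1 * \int[P]_(v in A) (`|X v - x (j (X v))| ^+ 2).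
pose aY := (fine (P A))^-1 * \int[P]_(v in A) (`|Y v - x (j (Y v))| ^+ 2).
pose B w := C * (6 * k * (Y w - X w) ^+ 2 +
    k^-1 * (\int[mX w]_t (`|t - x (j t)| ^+ 2) + aX +
            \int[mY w]_t (`|t - x (j t)| ^+ 2) + aY + 2 * e * S)).
have BA : P.-integrable A (EFin \o B) := Bi _ _ (ci aX) (ci aY).
apply: (@le_trans _ _ (\int[P]_(w in A) B w)).
  apply: (@le_trans _ _ (\int[P]_(w in A)
      ((gx (X w) mu - gx (Y w) nu) * (Y w - X w) + B w))); last first.
    rewrite RintegralD//; last exact: SA.
    by rewrite gerDr.
  apply: ae_le_Rintegral => //.
  - exact: SA.
  - exact: (integrableD mA (SA _ psii) BA).
  apply: filterS Gle => w Gw Aw; apply: le_trans Gw _.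
  have hX := W2_lipschitz_cond_law mA pA0 QE Qint mX' X2 mmX PAX
    (fun B _ => muE B) mj mr rt (fun v i => oscX w v i Aw) C0 (gxW (X w)) e0 k0
    (normr_ge0 (Y w - X w)).
  have hY := W2_lipschitz_cond_law mA pA0 QE Qint mY' Y2 mmY PAY
    (fun B _ => nuE B) mj mr rt (fun v i => oscY w v i Aw) C0 (gxW (Y w)) e0 k0
    (normr_ge0 (Y w - X w)).
  rewrite -/S -/aX real_normK ?num_real// in hX.
  rewrite -/S -/aY real_normK ?num_real// in hY.
  have n1 := ler_norm ((gx (X w) (mX w) - gx (X w) mu) * (Y w - X w)).
  have n3 := ler_norm (- ((gx (Y w) (mY w) - gx (Y w) nu) * (Y w - X w))).
  rewrite normrN in n3; rewrite !normrM in n1 n3.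
  have m1 := le_trans n1 hX; have m2 := le_trans n3 hY.
  rewrite /B; move: m1 m2; set hx := Rintegral _ _ _; set hy := Rintegral _ _ _.
  move=> m1 m2.
  have -> : C * (6 * k * (Y w - X w) ^+ 2 + k^-1 * (hx + aX + hy + aY + 2 * e * S))
   = C * (3 * k * (Y w - X w) ^+ 2 + k^-1 * (hx + e * S + aX)) +
     C * (3 * k * (Y w - X w) ^+ 2 + k^-1 * (hy + e * S + aY)) by ring.
  by move: m1 m2; lra.
pose fX w := `|X w - x (j (X w))| ^+ 2; pose fY w := `|Y w - x (j (Y w))| ^+ 2.
have key (a : R) (f : Omega -> R) : P.-integrable setT (EFin \o f) ->
    a = (fine (P A))^-1 * \int[P]_(v in A) f v ->
    \int[P]_(v in A) (f v - a) = 0.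
  move=> fi aE; rewrite RintegralB//; [|exact: SA|exact: SA].
  rewrite Rintegral_cst// aE mulrAC mulVf ?mul1r ?subrr//.
  by rewrite gt_eqF.
rewrite -subr_ge0 -RintegralB//; last exact: (Bi fX fY).
have iX : P.-integrable A (EFin \o (fun w => fX w - aX)).
  by apply: SA; exact: (integrableB measurableT dX (ci aX)).
have iY : P.-integrable A (EFin \o (fun w => fY w - aY)).
  by apply: SA; exact: (integrableB measurableT dY (ci aY)).
rewrite (@eq_Rintegral _ _ _ _ _ (fun w => C * k^-1 * ((fX w - aX) + (fY w - aY)))).
  rewrite RintegralZl//; last exact: (integrableD mA iX iY).
  by rewrite RintegralD// (key aX)// (key aY)// addr0 mulr0.
by move=> w _; rewrite /B /fX /fY; ring.
Qed.

(** Dominated convergence, with X^2 as the dominating function. *)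
Lemma rounding_error_cvg (R : realType) (d : measure_display)
    (Omega : measurableType d) (P : probability Omega R) (X : Omega -> R)
    (r : nat -> R -> R) (e : R) :
  measurable_fun setT X -> P.-integrable setT (fun w => ((X w) ^+ 2)%:E) ->
  (forall n, measurable_fun setT (r n)) ->
  (forall n x, `|x - r n x| <= `|x|) -> (forall x, r n x @[n --> \oo] --> x) ->
  0 < e ->
  \forall n \near \oo, \int[P]_w (`|X w - r n (X w)| ^+ 2) <= e.
Proof.
move=> mX X2 mr rle rcvg e0.
have md n : measurable_fun setT (fun w => `|X w - r n (X w)| ^+ 2).
  apply: measurable_funX; apply: measurableT_comp => //; apply: measurable_funB => //.
  exact: (measurableT_comp (mr n) mX).
have mdE n : measurable_fun setT (fun w => (`|X w - r n (X w)| ^+ 2)%:E).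
  exact/measurable_EFinP.
have ff : {ae P, forall w, setT w ->
    (fun n => (`|X w - r n (X w)| ^+ 2)%:E) @ \oo --> (0%E : \bar R)}.
  apply: aeW => w _; apply: cvg_EFin; first exact: nearW.
  have h0 : (X w - r n (X w)) @[n --> \oo] --> X w - X w.
    by apply: cvgB; [exact: cvg_cst|exact: rcvg].
  have h1 := cvg_norm h0; have := cvgM (h1 _) (h1 _).
  by rewrite subrr normr0 mulr0 => h2; exact: h2.
have fg : {ae P, forall w n, setT w ->
    (`|(`|X w - r n (X w)| ^+ 2)%:E| <= ((X w) ^+ 2)%:E)%E}.
  apply: aeW => w n _; rewrite abse_EFin lee_fin normrX normr_id.
  rewrite -[leRHS](real_normK (num_real (X w))).
  by rewrite lerXn2r ?nnegrE.
have [_ _] := dominated_convergence measurableT mdE (measurable_cst 0%E) ff X2 fg.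
by rewrite integral0 => /fine_cvgP[_] /cvgr_le; exact.
Qed.

(** The pieces of the partition belong to [F], so the conditional-law identities hold on each of
    them, and the estimates add up to a bound that no longer sees the partition. *)
Lemma cond_law_monotone (R : realType) (d : measure_display)
    (Omega : measurableType d) (P : probability Omega R) (F : set (set Omega))
    (X Y : Omega -> R) (mX mY : Omega -> P2 R) (gx : R -> P2 R -> R) (C : R)
    (G : Omega -> R) :
  sigma_algebra setT F -> F `<=` measurable ->
  measurable_fun setT X -> measurable_fun setT Y ->
  P.-integrable setT (fun w => ((X w) ^+ 2)%:E) ->
  P.-integrable setT (fun w => ((Y w) ^+ 2)%:E) ->
  is_cond_law P F X mX -> is_cond_law P F Y mY ->
  0 <= C ->
  (forall x x' m, `|gx x m - gx x' m| <= C * `|x - x'|) ->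
  (forall x m m', `|gx x m - gx x m'| <= C * W2 m m') ->
  (forall (m m' : P2 R) (gamma : probability (R * R)%type R),
     (\int[gamma]_p (p.1 ^+ 2 + p.2 ^+ 2)%:E < +oo)%E ->
     coupling m m' gamma ->
     (0 <= \int[gamma]_p ((gx p.1 m - gx p.2 m') * (p.1 - p.2))%:E)%E) ->
  P.-integrable setT (EFin \o G) ->
  {ae P, forall w, G w <= (gx (X w) (mX w) - gx (Y w) (mY w)) * (Y w - X w)} ->
  \int[P]_w G w <= 0.
Proof.
move=> sF Fm mX' mY' X2 Y2 clX clY C0 gxC gxW mono Gi Gle.
have FT : F setT by case: sF => F0 FC _; rewrite -(setD0 setT); exact: FC.
have mmX B : measurable B -> measurable_fun setT (fun w => mX w B).
  by move=> /clX[mB _]; exact: sub_sigma_measurable_fun mB.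
have mmY B : measurable B -> measurable_fun setT (fun w => mY w B).
  by move=> /clY[mB _]; exact: sub_sigma_measurable_fun mB.
have PX B : measurable B -> (\int[P]_w mX w B = P (X @^-1` B))%E.
  by move=> /clX[_ /(_ _ FT)]; rewrite setTI.
have PY B : measurable B -> (\int[P]_w mY w B = P (Y @^-1` B))%E.
  by move=> /clY[_ /(_ _ FT)]; rewrite setTI.
have D2 : P.-integrable setT (fun w => ((Y w - X w) ^+ 2)%:E).
  have i1 := integrable_mul_sqr measurableT mX' mY' X2 Y2.
  have := integrableB measurableT (integrableD measurableT X2 Y2)
    (integrableZl measurableT 2 i1).
  apply: eq_integrable => // w _ /=.
  by congr (_%:E); ring.
pose V := \int[P]_w ((Y w - X w) ^+ 2).
have V0 : 0 <= V by apply: Rintegral_ge0 => w _; exact: sqr_ge0.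
(* In 6 t, the rounding errors of [X], of [Y] and of their two conditional laws count for t each,
   and the oscillation term 2 e S for 2 t. *)
suff bound k t : 0 < k -> 0 < t ->
    \int[P]_w G w <= C * (6 * k * V + k^-1 * (6 * t)).
  rewrite leNgt; apply/negP => g0; set g := Rintegral _ _ _ in bound g0.
  (* With t = k^2 the bound becomes M k; if the integral g were positive, k = g / (M + 1) would give
     g <= M k < (M + 1) k = g. *)
  pose M := 6 * C * (V + 1).
  have M0 : 0 <= M by rewrite /M !mulr_ge0 ?addr_ge0.
  have k0 : 0 < g / (M + 1) by rewrite divr_gt0// ltr_wpDl.
  have := bound _ _ k0 (mulr_gt0 k0 k0).
  set k := g / (M + 1) in k0 *.
  have -> : C * (6 * k * V + k^-1 * (6 * (k * k))) = M * k.
    by rewrite /M; field; rewrite gt_eqF.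
  have gE : g = (M + 1) * k by rewrite /k mulrC divfK// gt_eqF// ltr_wpDl.
  by rewrite {1}gE; lra.
move=> k0 t0.
have [r [mr fr rle rcvg]] := simple_rounding R.
have [n [errX errY]] : exists n,
    \int[P]_w (`|X w - r n (X w)| ^+ 2) <= t /\
    \int[P]_w (`|Y w - r n (Y w)| ^+ 2) <= t.
  have hX := rounding_error_cvg mX' X2 mr rle rcvg t0.
  have hY := rounding_error_cvg mY' Y2 mr rle rcvg t0.
  by have [n _ hn] := filterI hX hY; exists n; apply: hn => /=.
have [I [j [x [rE mj]]]] := finite_range_factor (mr n) (fr n).
have {}rE : r n = x \o j by apply/funext => y; exact: rE.
move: (mr n) (rle n) errX errY; rewrite rE => mxj xjle errX errY.
pose S := \sum_i \sum_l `|x i - x l| ^+ 2.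
have S0 : 0 <= S by do 2 apply: sumr_ge0 => ? _; rewrite sqr_ge0.
(* The mesh is adapted to the spread [S] of the rounded values; adding 1 keeps the denominator
   positive. *)
pose e := t / (S + 1).
have e0 : 0 < e by rewrite divr_gt0// ltr_wpDl.
have eS : e * S <= t.
  have S1 : 0 < S + 1 by rewrite ltr_wpDl.
  by rewrite /e mulrAC ler_pdivrMr// ler_pM2l// lerDl.
(* The masses under both conditional laws form one family, so that a single partition serves for
   both. Letting [w] range over [Omega] with the sigma-algebra [F] puts the pieces in [F]. *)
pose f (i : I + I) (w : g_sigma_algebraType F) : R := match i with
  | inl i => fine (mX w (j @^-1` [set i]))
  | inr i => fine (mY w (j @^-1` [set i])) end.
have mf i : measurable_fun setT (f i).
  case: i => i; apply: measurableT_comp => //.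
    by have [] := clX _ (mj i).
  by have [] := clY _ (mj i).
have f01 i w : 0 <= f i w <= 1.
  by case: i => i; rewrite /f fine_ge0//= -lee_fin fineK ?fin_num_measure//
    probability_le1.
have [K [kap [mkap osc]]] := finite_oscillation_partition e0 mf f01.
have Fkap c : F (kap @^-1` [set c]).
  by have := mkap c; rewrite /measurable/= (sigma_algebra_id sF).
have mkap' c : d.-measurable (kap @^-1` [set c]) by apply: Fm; exact: Fkap.
have [dX HXi HXE] := cond_law_rounding_error mX' X2 mmX PX mxj xjle.
have [dY HYi HYE] := cond_law_rounding_error mY' Y2 mmY PY mxj xjle.
pose B w := C * (6 * k * (Y w - X w) ^+ 2 +
    k^-1 * (\int[mX w]_t (`|t - x (j t)| ^+ 2) + `|X w - x (j (X w))| ^+ 2 +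
            \int[mY w]_t (`|t - x (j t)| ^+ 2) + `|Y w - x (j (Y w))| ^+ 2 +
            2 * e * S)).
have ci (c : R) : P.-integrable setT (EFin \o (fun=> c)).
  exact: finite_measure_integrable_cst.
have i2 := integrableD measurableT HXi dX.
have i3 := integrableD measurableT i2 HYi.
have i4 := integrableD measurableT i3 dY.
have i5 := integrableD measurableT i4 (ci (2 * e * S)).
have i6 := integrableZl measurableT k^-1 i5.
have i7 := integrableZl measurableT (6 * k) D2.
have i8 := integrableD measurableT i7 i6.
have Bi : P.-integrable setT (EFin \o B).
  by have := integrableZl measurableT C i8; apply: eq_integrable => // w _.
apply: (@le_trans _ _ (\int[P]_w B w)).
  rewrite (Rintegral_fibres mkap' Gi) (Rintegral_fibres mkap' Bi).
  apply: ler_sum => c _; apply: cond_law_monotone_piece => //.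
  - by move=> D /clX[_ /(_ _ (Fkap c))].
  - by move=> D /clY[_ /(_ _ (Fkap c))].
  - by move=> w v i wc vc; apply: (osc _ _ (inl i)); rewrite wc vc.
  - by move=> w v i wc vc; apply: (osc _ _ (inr i)); rewrite wc vc.
  - exact: ltW.
rewrite /B RintegralZl// ler_wpM2l// RintegralD// RintegralZl// -/V lerD2l.
rewrite RintegralZl// ler_wpM2l ?invr_ge0 ?(ltW k0)//.
rewrite !RintegralD// HXE HYE Rintegral_cst//.
rewrite [fine _](congr1 fine (probability_setT P))/=.
by move: errX errY eS => /=; lra.
Qed.

(** * Controls and state processes *)

(** The density of parameter s, times x^2, is dominated by a multiple of the density of parameter 2
    s. With u = x^2 / (8 s^2) the exponentials are exp(-4u) and exp(-u), and u exp(-u) <= 1 absorbs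
    the square; [c] is 8 s^2 times the ratio of the peaks. *)
Lemma normal_second_moment (R : realType) (s : R) : s != 0 ->
  (\int[normal_prob 0 s]_x (x ^+ 2)%:E < +oo)%E.
Proof.
move=> s0; set nu := (X in integral X).
pose mu := @lebesgue_measure R.
pose RN := Radon_Nikodym_SigmaFinite.f nu mu.
have dom : nu `<< mu by exact: normal_prob_dominates.
have RNi := Radon_Nikodym_SigmaFinite.f_integrable dom.
(* The Radon-Nikodym derivative and the explicit density have the same integral over every
   measurable set. *)
have RNE : ae_eq mu setT RN (fun x => (normal_pdf 0 s x)%:E).
  apply: integral_ae_eq => //.
    by apply/measurable_EFinP; exact: measurable_normal_pdf.
  by move=> A _ mA; rewrite -Radon_Nikodym_SigmaFinite.f_integral.
have mRN : measurable_fun setT RN by exact: (measurable_int mu).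
have msq : measurable_fun setT (fun x : R => (x ^+ 2)%:E).
  by apply/measurable_EFinP; exact: exprn_measurable.
rewrite -(Radon_Nikodym_SigmaFinite.change_of_variables dom)//; last first.
  by move=> x; rewrite lee_fin sqr_ge0.
have -> : (\int[mu]_x ((x ^+ 2)%:E * RN x) =
    \int[mu]_x ((x ^+ 2)%:E * (normal_pdf 0 s x)%:E))%E.
  apply: ae_eq_integral => //.
  - exact: emeasurable_funM.
  - apply: emeasurable_funM => //; apply/measurable_EFinP.
    exact: measurable_normal_pdf.
  - by apply: filterS RNE => x /[apply] ->.
pose c := 8 * s ^+ 2 * normal_peak s / normal_peak (2 * s).
  have s20 : 2 * s != 0 by rewrite mulf_neq0.
  have bnd x : x ^+ 2 * normal_pdf 0 s x <= c * normal_pdf 0 (2 * s) x.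
    rewrite !normal_pdfE//= /c [leRHS]mulrA divfK ?gt_eqF ?normal_peak_gt0//.
    rewrite /normal_fun !subr0.
    have ss : 0 < s ^+ 2 by rewrite exprn_even_gt0.
    pose u := x ^+ 2 / (8 * s ^+ 2).
    have u0 : 0 <= u by rewrite divr_ge0 ?sqr_ge0// mulr_ge0// ltW.
    have xE : x ^+ 2 = 8 * s ^+ 2 * u by rewrite /u; field.
    have -> : - x ^+ 2 / (s ^+ 2 *+ 2) = - u + (- u + (- u + - u)).
      by rewrite xE; field.
    have -> : - x ^+ 2 / ((2 * s) ^+ 2 *+ 2) = - u by rewrite xE; field.
    rewrite !expRD [in leLHS]xE; set v := expR (- u); set p := normal_peak s.
    have v0 : 0 <= v by exact: expR_ge0.
    have v1 : v <= 1 by rewrite -expR0 ler_expR oppr_le0.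
    have uv : u * v <= 1.
      rewrite /v expRN ler_pdivrMr ?expR_gt0// mul1r.
      by apply: le_trans (expR_ge1Dx u); rewrite lerDr.
    have -> : 8 * s ^+ 2 * u * (p * (v * (v * (v * v)))) =
      (8 * s ^+ 2 * p * v) * (u * v * (v * v)) by ring.
    have uv0 : 0 <= u * v by rewrite mulr_ge0.
    have vv0 : 0 <= v * v by rewrite mulr_ge0.
    have p0 : 0 <= p by exact: normal_peak_ge0.
    have q0 : 0 <= 8 * s ^+ 2 * p * v.
      by do 3 apply: mulr_ge0 => //; exact: ltW.
    have vv1 : v * v <= 1 by exact: mulr_ile1.
    have uvv : u * v * (v * v) <= 1 by exact: mulr_ile1.
    exact: ler_piMr.
  have ci := integrableZl measurableT c (integrable_normal_pdf 0 (2 * s)).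
  apply: le_lt_trans (integrable_lty measurableT ci).
  apply: ge0_le_integral => //.
  - by move=> x _; rewrite -EFinM lee_fin mulr_ge0 ?sqr_ge0 ?normal_pdf_ge0.
  - apply: emeasurable_funM => //; apply/measurable_EFinP.
    exact: measurable_normal_pdf.
  - exact: (measurable_int mu).
  - by move=> x _; rewrite -!EFinM lee_fin bnd.
Qed.

(** Almost surely [W T] equals the increment W T - W 0, which is Gaussian with standard deviation
    sqrt(T). *)
Lemma brownian_sqr_integrable (R : realType) (d : measure_display)
    (Omega : measurableType d) (P : probability Omega R) (T : R)
    (W : R -> Omega -> R) :
  0 < T -> brownian P T W -> P.-integrable setT (fun w => ((W T w) ^+ 2)%:E).
Proof.
move=> T0 bW.
have mW t : 0 <= t <= T -> measurable_fun setT (W t) by exact: brownian_measurable bW t.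
have mWT : measurable_fun setT (W T) by apply: mW; rewrite lexx ltW.
have mW0 : measurable_fun setT (W 0) by apply: mW; rewrite lexx ltW.
have mI : measurable_fun setT (W T \- W 0) by exact: measurable_funB.
apply/integrableP; split.
  by apply/measurable_EFinP; exact: measurable_funX.
rewrite (eq_integral (fun w => ((W T w) ^+ 2)%:E)); last first.
  by move=> w _; rewrite gee0_abs// lee_fin sqr_ge0.
rewrite (ae_eq_integral (fun w => (((W T \- W 0) w) ^+ 2)%:E))//.
- have [Q [QE Qint _]] := @pushforward_probability R _ _ Omega (measurableTypeR R) P _ mI.
  rewrite -(Qint (fun x : R => (x ^+ 2)%:E)); last 2 first.
  - by apply/measurable_EFinP; exact: exprn_measurable.
  - by move=> y; rewrite lee_fin sqr_ge0.
  have -> : (\int[Q]_x (x ^+ 2)%:E =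
      \int[normal_prob 0 (Num.sqrt T)]_x (x ^+ 2)%:E)%E.
    apply: eq_measure_integral => A mA _.
    etransitivity; first exact: QE.
    rewrite -[in RHS](subr0 T).
    exact: (brownian_gaussian bW).
  by apply: normal_second_moment; rewrite gt_eqF// sqrtr_gt0.
- by apply/measurable_EFinP; exact: measurable_funX.
- by apply/measurable_EFinP; exact: measurable_funX.
- by apply: filterS (brownian_start bW) => w w0 _ /=; rewrite w0 subr0.
Qed.

(** * Integration in time and joint measurability *)

(** Cauchy-Schwarz, obtained from the nonnegativity of the integral of (f - c)^2 with c the mean of
    [f]. An infinite right-hand side settles the claim whatever default value the left-hand integral
    takes. *)
Lemma sqr_Rintegral_le (R : realType) (T : R) (f : R -> R) :
  0 < T -> measurable_fun `[0, T] f ->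
  (((\int[lebesgue_measure]_(t in `[0%R, T]) f t) ^+ 2)%:E <=
   T%:E * \int[lebesgue_measure]_(t in `[0%R, T]) ((f t) ^+ 2)%:E)%E.
Proof.
move=> T0 mf; set mu := lebesgue_measure.
have mD : measurable (`[0, T]%classic : set (measurableTypeR R)) by exact: measurable_itv.
have muD : mu `[0%R, T]%classic = T%:E.
  by rewrite /mu lebesgue_measure_itv/= lte_fin T0 oppr0 adde0.
have muDy : (mu `[0%R, T]%classic < +oo)%E by rewrite muD ltry.
have S0 : (0 <= \int[mu]_(t in `[0%R, T]) ((f t) ^+ 2)%:E)%E.
  by apply: integral_ge0 => t _; rewrite lee_fin sqr_ge0.
have [Sy|Sfin] := eqVneq (\int[mu]_(t in `[0%R, T]) ((f t) ^+ 2)%:E)%E +oo%E.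
  by rewrite Sy gt0_muley ?lte_fin// leey.
have f2 : mu.-integrable `[0%R, T] (fun t => ((f t) ^+ 2)%:E).
  apply/integrableP; split; first by apply/measurable_EFinP; exact: measurable_funX.
  under eq_integral do rewrite gee0_abs ?lee_fin ?sqr_ge0//.
  by rewrite ltey.
have f1 : mu.-integrable `[0%R, T] (EFin \o f) by exact: integrable_of_sqr f2.
set I := Rintegral _ _ _.
pose S := \int[mu]_(t in `[0, T]) ((f t) ^+ 2).
have SE : (\int[mu]_(t in `[0%R, T]) ((f t) ^+ 2)%:E)%E = S%:E.
  by rewrite /S /Rintegral fineK//; exact: integrable_fin_num.
rewrite SE -EFinM lee_fin.
pose c := I / T.
have ci (k : R) : mu.-integrable `[0%R, T] (EFin \o (fun=> k)).
  apply/integrableP; split; first exact: measurable_cst.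
  under eq_integral do rewrite /=.
  by rewrite integral_cst// [X in (_ * X)%E]muD -EFinM ltry.
have : 0 <= \int[mu]_(t in `[0, T]) ((f t - c) ^+ 2).
  by apply: Rintegral_ge0 => t _; rewrite sqr_ge0.
have -> : \int[mu]_(t in `[0, T]) ((f t - c) ^+ 2) =
    \int[mu]_(t in `[0, T]) ((f t ^+ 2 - 2 * c * f t) + c ^+ 2).
  by apply: eq_Rintegral => t _; ring.
have i1 := integrableZl mD (2 * c) f1.
have i2 := integrableB mD f2 i1.
rewrite RintegralD// RintegralB// RintegralZl// Rintegral_cst// [fine _](congr1 fine muD)/= -/S -/I.
have -> : S - 2 * c * I + c ^+ 2 * T = (T * S - I ^+ 2) / T.
  by rewrite /c; field; rewrite gt_eqF.
by rewrite pmulr_lge0 ?invr_gt0// subr_ge0.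
Qed.

(** The identity from [Omega] to [Omega] with the sigma-algebra [F T] is measurable; composing with
    it carries progressive measurability at the final time to the ambient sigma-algebra. *)
Lemma progressive_measurable (R : realType) (d : measure_display)
    (Omega : measurableType d) (T : R) (F : R -> set (set Omega))
    (b : R -> Omega -> R) :
  0 < T -> sigma_algebra setT (F T) -> F T `<=` measurable ->
  progressive T F b ->
  measurable_fun (`[0, T] `*` setT : set (measurableTypeR R * Omega))
    (fun p => b p.1 p.2).
Proof.
move=> T0 sF Fm pb.
have mb := pb T; rewrite lexx ltW// in mb; have {}mb := mb isT.
have mid : measurable_fun setT (id : Omega -> g_sigma_algebraType (F T)).
  move=> _ B mB; rewrite setTI; apply: Fm.
  by move: mB; rewrite /measurable/= (sigma_algebra_id sF).
have mi : measurable_fun setT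
    (fun p : measurableTypeR R * Omega => (p.1, p.2) : R * g_sigma_algebraType (F T)).
  apply: measurable_fun_pair; first exact: measurable_fst.
  exact: (measurableT_comp mid measurable_snd).
have mD : measurable (`[0, T] `*` setT : set (R * g_sigma_algebraType (F T))).
  by apply: measurableX => //; exact: measurable_itv.
apply: (measurable_comp (g := fun p : measurableTypeR R * Omega =>
  (p.1, p.2) : R * g_sigma_algebraType (F T)) mD _ mb).
  by move=> _ [[t w] [/= tT _] <-].
exact: measurable_funTS mi.
Qed.

Lemma section_measurable (R : realType) (d : measure_display)
    (Omega : measurableType d) (T : R) (f : R -> Omega -> R) (w : Omega) :
  measurable_fun (`[0, T] `*` setT : set (measurableTypeR R * Omega))
    (fun p => f p.1 p.2) ->
  measurable_fun (`[0, T] : set (measurableTypeR R)) (f ^~ w).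
Proof.
move=> mf.
have mD : measurable (`[0, T] `*` setT : set (measurableTypeR R * Omega)).
  by apply: measurableX => //; exact: measurable_itv.
apply: (measurable_comp (F := `[0, T] `*` setT) (g := fun t => (t, w))
  (f := fun p => f p.1 p.2) mD _ mf).
  by move=> _ [t /= tT <-].
exact: measurable_funTS (pair2_measurable w).
Qed.

Lemma tonelli_strip (R : realType) (d : measure_display)
    (Omega : measurableType d) (P : probability Omega R) (T : R)
    (f : R -> Omega -> R) :
  measurable_fun (`[0, T] `*` setT : set (measurableTypeR R * Omega))
    (fun p => f p.1 p.2) ->
  (forall t w, 0 <= f t w) ->
  measurable_fun setT
    (fun w => \int[lebesgue_measure]_(t in `[0%R, T]) (f t w)%:E)%E /\
  (\int[(@lebesgue_measure R \x P)%E]_(p in `[0%R, T] `*` setT)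
     (f p.1 p.2)%:E =
   \int[P]_w \int[lebesgue_measure]_(t in `[0%R, T]) (f t w)%:E)%E.
Proof.
move=> mf f0.
pose D : set (measurableTypeR R * Omega) := `[0, T] `*` setT.
have mD : measurable D by apply: measurableX => //; exact: measurable_itv.
(* Extension by 0 outside the strip, so that Tonelli's theorem applies on the whole product
   space. *)
pose g := (fun p : measurableTypeR R * Omega => (f p.1 p.2)%:E) \_ D.
have mg : measurable_fun setT g.
  have mfE : measurable_fun D (fun p => (f p.1 p.2)%:E) by exact/measurable_EFinP.
  exact: (measurable_restrictT _ mD).1 mfE.
have g0 p : (0 <= g p)%E by rewrite /g erestrict_ge0// => *; rewrite lee_fin.
have gE w : (\int[lebesgue_measure]_(t in `[0%R, T]) (f t w)%:E)%E =
    fubini_G (@lebesgue_measure R) g w.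
  rewrite /fubini_G [LHS]integral_mkcond; congr (integral _ _ _); apply/funext => t.
  have DE : ((t, w) \in D) = (t \in `[0, T]%classic).
    by apply/idP/idP; rewrite !inE; [case|move=> tT; split].
  by rewrite /g !patchE DE.
rewrite (funext gE); split.
  exact: measurable_fun_fubini_tonelli_G.
rewrite integral_mkcond fubini_tonelli2//.
Qed.

(** Tonelli's theorem handles the positive and negative parts. Their difference stays measurable
    even on paths where both integrals are infinite and the value is a default one. *)
Lemma drift_measurable (R : realType) (d : measure_display)
    (Omega : measurableType d) (P : probability Omega R) (T : R)
    (f : R -> Omega -> R) :
  measurable_fun (`[0, T] `*` setT : set (measurableTypeR R * Omega))
    (fun p => f p.1 p.2) ->
  measurable_fun setT (fun w => \int[lebesgue_measure]_(t in `[0, T]) f t w).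
Proof.
move=> mf.
pose fp t w : R := Order.max (f t w) 0; pose fn t w : R := Order.max (- f t w) 0.
have mfp : measurable_fun (`[0, T] `*` setT : set (measurableTypeR R * Omega))
    (fun p => fp p.1 p.2) by exact: measurable_funrpos.
have mfn : measurable_fun (`[0, T] `*` setT : set (measurableTypeR R * Omega))
    (fun p => fn p.1 p.2) by exact: measurable_funrneg.
have fp0 t w : 0 <= fp t w by rewrite /fp le_max lexx orbT.
have fn0 t w : 0 <= fn t w by rewrite /fn le_max lexx orbT.
have [mp _] := tonelli_strip P mfp fp0.
have [mn _] := tonelli_strip P mfn fn0.
apply: measurableT_comp => //.
under eq_fun do rewrite integralE.
have -> : (fun w => \int[lebesgue_measure]_(t in `[0%R, T]) (fun t => (f t w)%:E)^\+ t -
   \int[lebesgue_measure]_(t in `[0%R, T]) (fun t => (f t w)%:E)^\- t)%E =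
  (fun w => \int[lebesgue_measure]_(t in `[0%R, T]) (fp t w)%:E -
   \int[lebesgue_measure]_(t in `[0%R, T]) (fn t w)%:E)%E.
  apply/funext => w; congr (_ - _)%E; apply: eq_integral => t _.
    by rewrite funeposE EFin_max.
  by rewrite funenegE EFin_max.
exact: emeasurable_funB.
Qed.

(** * Energy and drift of square-integrable controls *)

Section controls.
Context (R : realType) (d : measure_display) (Omega : measurableType d).
Variables (P : probability Omega R) (T : R) (F : R -> set (set Omega)).
Hypotheses (T0 : 0 < T) (sF : sigma_algebra setT (F T))
  (Fm : F T `<=` measurable).

Local Notation leb := (@lebesgue_measure R).
Let strip : set (measurableTypeR R * Omega) := `[0, T] `*` setT.

(** Taken for the product measure, so that zero energy of a difference gives [H2_eq] directly;
    Tonelli's theorem identifies it with the iterated integral of [H2]. *)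
Definition energy (a : R -> Omega -> R) : R :=
  \int[(leb \x P)%E]_(p in strip) ((a p.1 p.2) ^+ 2).

Definition drift (a : R -> Omega -> R) (w : Omega) : R :=
  \int[leb]_(t in `[0, T]) a t w.

Lemma measurable_strip : measurable strip.
Proof. by apply: measurableX => //; exact: measurable_itv. Qed.

Lemma H2_measurable a : H2 P T F a -> measurable_fun strip (fun p => a p.1 p.2).
Proof. by move=> [pa _]; exact: progressive_measurable pa. Qed.

Lemma H2_tonelli a : H2 P T F a ->
  measurable_fun setT
    (fun w => \int[leb]_(t in `[0%R, T]) ((a t w) ^+ 2)%:E)%E /\
  (\int[(leb \x P)%E]_(p in strip) ((a p.1 p.2) ^+ 2)%:E =
   \int[P]_w \int[leb]_(t in `[0%R, T]) ((a t w) ^+ 2)%:E)%E.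
Proof.
move=> Ha; have ma := H2_measurable Ha.
apply: (@tonelli_strip _ _ _ P T (fun t w => (a t w) ^+ 2)).
  exact: measurable_funX ma.
by move=> t w; rewrite sqr_ge0.
Qed.

Lemma H2_sqr_integrable a : H2 P T F a ->
  (leb \x P)%E.-integrable strip (fun p => ((a p.1 p.2) ^+ 2)%:E).
Proof.
move=> Ha; have ma := H2_measurable Ha; apply/integrableP; split.
  by apply/measurable_EFinP; exact: measurable_funX ma.
under eq_integral do rewrite gee0_abs ?lee_fin ?sqr_ge0//.
by have [_ ->] := H2_tonelli Ha; case: Ha.
Qed.

Lemma energy_section_ge0 (a : R -> Omega -> R) w :
  (0 <= \int[leb]_(t in `[0%R, T]) ((a t w) ^+ 2)%:E)%E.
Proof. by apply: integral_ge0 => t _; rewrite lee_fin sqr_ge0. Qed.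

Lemma H2_integrable_energy a : H2 P T F a ->
  P.-integrable setT
    (fun w => \int[leb]_(t in `[0%R, T]) ((a t w) ^+ 2)%:E)%E.
Proof.
move=> Ha; have [mE _] := H2_tonelli Ha; apply/integrableP; split => //.
under eq_integral do rewrite gee0_abs ?energy_section_ge0//.
by case: Ha.
Qed.

Lemma H2_ae_section a : H2 P T F a ->
  {ae P, forall w, leb.-integrable `[0%R, T] (fun t => ((a t w) ^+ 2)%:E)}.
Proof.
move=> Ha; have := integrable_ae measurableT (H2_integrable_energy Ha).
apply: filterS => w /(_ Logic.I) fin; apply/integrableP; split.
  apply/measurable_EFinP; apply: measurable_funX.
  exact: section_measurable (H2_measurable Ha).
under eq_integral do rewrite gee0_abs ?lee_fin ?sqr_ge0//.
by rewrite ltey_eq fin.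
Qed.

Lemma H2_drift a : H2 P T F a ->
  measurable_fun setT (drift a) /\
  P.-integrable setT (fun w => ((drift a w) ^+ 2)%:E).
Proof.
move=> Ha; have ma := H2_measurable Ha.
have md : measurable_fun setT (drift a) by exact: drift_measurable P _ _ ma.
split => //; have Ei := integrableZl measurableT T (H2_integrable_energy Ha).
apply: le_integrable Ei => //.
  by apply/measurable_EFinP; exact: measurable_funX.
move=> w _; rewrite gee0_abs ?lee_fin ?sqr_ge0//; apply: le_trans (lee_abs _).
apply: sqr_Rintegral_le => //; exact: section_measurable ma.
Qed.

(** The last term expresses the strong convexity of the square; once integrated, it is the source of
    uniqueness. *)
Lemma sqr_interp (x y e : R) :
  (x + e * (y - x)) ^+ 2 =
  (1 - e) * x ^+ 2 + e * y ^+ 2 - e * (1 - e) * (y - x) ^+ 2.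
Proof. by ring. Qed.

Lemma H2_interp a b e : 0 <= e <= 1 -> H2 P T F a -> H2 P T F b ->
  H2 P T F (fun t w => a t w + e * (b t w - a t w)).
Proof.
move=> /andP[e0 e1] Ha Hb; split.
  move=> t tT; have [[pa _] [pb _]] := (Ha, Hb).
  apply: measurable_funD; first exact: pa.
  apply: measurable_funM; first exact: measurable_cst.
  by apply: measurable_funB; [exact: pb|exact: pa].
have [[ma Ea] [mb Eb]] := (H2_tonelli Ha, H2_tonelli Hb).
have secm c w : H2 P T F c ->
    measurable_fun (`[0, T]%classic : set (measurableTypeR R))
      (fun t => ((c t w) ^+ 2)%:E).
  move=> Hc; apply/measurable_EFinP; apply: measurable_funX.
  exact: section_measurable (H2_measurable Hc).
apply: (@le_lt_trans _ _ (\int[P]_w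
   (\int[leb]_(t in `[0%R, T]) ((a t w) ^+ 2)%:E +
    \int[leb]_(t in `[0%R, T]) ((b t w) ^+ 2)%:E))%E); last first.
  rewrite ge0_integralD//.
  - by rewrite lte_add_pinfty//; [case: Ha|case: Hb].
  - by move=> w _; exact: energy_section_ge0.
  - by move=> w _; exact: energy_section_ge0.
have mc : measurable_fun strip (fun p => a p.1 p.2 + e * (b p.1 p.2 - a p.1 p.2)).
  apply: measurable_funD; first exact: H2_measurable.
  apply: measurable_funM; first exact: measurable_cst.
  by apply: measurable_funB; exact: H2_measurable.
apply: ge0_le_integral => //.
- by move=> w _; exact: (energy_section_ge0 (fun t w => a t w + e * (b t w - a t w))).
- apply: (tonelli_strip (f := fun t w => (a t w + e * (b t w - a t w)) ^+ 2)
    P _ _).1.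
    exact: measurable_funX mc.
  by move=> t w; rewrite sqr_ge0.
- exact: emeasurable_funD.
move=> w _; rewrite -ge0_integralD//; last 4 first.
- by move=> t _; rewrite lee_fin sqr_ge0.
- exact: secm.
- by move=> t _; rewrite lee_fin sqr_ge0.
- exact: secm.
apply: ge0_le_integral.
- exact: measurable_itv.
- by move=> t _; rewrite lee_fin sqr_ge0.
- apply/measurable_EFinP; apply: measurable_funX.
  exact: (section_measurable (f := fun t w => a t w + e * (b t w - a t w)) w mc).
- by apply: emeasurable_funD; exact: secm.
(* For e in [0, 1] the identity bounds the interpolated square by a^2 + b^2. *)
- move=> t _; rewrite -EFinD lee_fin sqr_interp.
  have e2 : 0 <= 1 - e by rewrite subr_ge0.
  have h1 := mulr_ge0 e0 (sqr_ge0 (a t w)).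
  have h2 := mulr_ge0 e2 (sqr_ge0 (b t w)).
  have h3 := mulr_ge0 (mulr_ge0 e0 e2) (sqr_ge0 (b t w - a t w)).
  by lra.
Qed.

Lemma energy_interp a b e : H2 P T F a -> H2 P T F b ->
  energy (fun t w => a t w + e * (b t w - a t w)) =
  (1 - e) * energy a + e * energy b -
  e * (1 - e) * energy (fun t w => b t w - a t w) /\
  (leb \x P)%E.-integrable strip (fun p => ((b p.1 p.2 - a p.1 p.2) ^+ 2)%:E).
Proof.
move=> Ha Hb; have mS := measurable_strip.
have ia := H2_sqr_integrable Ha; have ib := H2_sqr_integrable Hb.
have iab := integrable_mul_sqr mS (H2_measurable Ha) (H2_measurable Hb) ia ib.
have id : (leb \x P)%E.-integrable strip
    (fun p => ((b p.1 p.2 - a p.1 p.2) ^+ 2)%:E).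
  have := integrableB mS (integrableD mS ia ib) (integrableZl mS 2 iab).
  apply: eq_integrable => // p _ /=.
  by congr (_%:E); ring.
split => //; rewrite /energy.
have -> : \int[(leb \x P)%E]_(p in strip)
     ((a p.1 p.2 + e * (b p.1 p.2 - a p.1 p.2)) ^+ 2) =
   \int[(leb \x P)%E]_(p in strip)
     ((1 - e) * (a p.1 p.2) ^+ 2 + e * (b p.1 p.2) ^+ 2 -
      e * (1 - e) * (b p.1 p.2 - a p.1 p.2) ^+ 2).
  by apply: eq_Rintegral => p _; rewrite sqr_interp.
have i1 := integrableZl mS (1 - e) ia; have i2 := integrableZl mS e ib.
have i3 := integrableZl mS (e * (1 - e)) id.
by rewrite RintegralB ?RintegralD ?RintegralZl//; exact: integrableD i1 i2.
Qed.

(** Almost sure only: on paths that are not integrable, the default value of the integral may break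
    linearity. *)
Lemma drift_interp a b e : H2 P T F a -> H2 P T F b ->
  {ae P, forall w, drift (fun t w => a t w + e * (b t w - a t w)) w =
     drift a w + e * (drift b w - drift a w)}.
Proof.
move=> Ha Hb; apply: filterS2 (H2_ae_section Ha) (H2_ae_section Hb) => w ia ib.
have mI : measurable (`[0, T]%classic : set (measurableTypeR R)).
  exact: measurable_itv.
have muI : (leb `[0%R, T]%classic < +oo)%E.
  by rewrite lebesgue_measure_itv/= lte_fin T0 oppr0 adde0 ltry.
have {}ia := integrable_of_sqr mI muI
  (section_measurable w (H2_measurable Ha)) ia.
have {}ib := integrable_of_sqr mI muI
  (section_measurable w (H2_measurable Hb)) ib.
have iba := integrableB mI ib ia.
by rewrite /drift RintegralD ?RintegralZl ?RintegralB//; exact: integrableZl iba.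
Qed.

Lemma cost_energy (g : R -> P2 R -> R) a X (m : R -> Omega -> P2 R) :
  H2 P T F a -> P.-integrable setT (fun w => (g (X T w) (m T w))%:E) ->
  cost P T g a X m = (energy a / 2 + \int[P]_w g (X T w) (m T w))%:E.
Proof.
move=> Ha gi; have Ei := H2_integrable_energy Ha.
have halfE w : (\int[leb]_(t in `[0%R, T]) ((a t w) ^+ 2 / 2)%:E =
    2^-1%:E * \int[leb]_(t in `[0%R, T]) ((a t w) ^+ 2)%:E)%E.
  rewrite -ge0_integralZl//.
  - by apply: eq_integral => t _; rewrite -EFinM mulrC.
  - apply/measurable_EFinP; apply: measurable_funX.
    exact: section_measurable (H2_measurable Ha).
  - by move=> t _; rewrite lee_fin sqr_ge0.
rewrite /cost; under eq_integral do rewrite halfE.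
rewrite integralD//; last exact: integrableZl.
rewrite integralZl// EFinD; congr (_ + _)%E.
  have [_ <-] := H2_tonelli Ha.
  rewrite mulrC EFinM /energy /Rintegral fineK//.
  by apply: integrable_fin_num; [exact: measurable_strip|exact: H2_sqr_integrable].
by rewrite /Rintegral fineK//; exact: integrable_fin_num.
Qed.

Lemma energy_eq0 a b : H2 P T F a -> H2 P T F b ->
  energy (fun t w => b t w - a t w) = 0 -> H2_eq P T a b.
Proof.
(* Called for the integrability of (b - a)^2; the parameter 0 is arbitrary. *)
move=> Ha Hb; have [_ id] := energy_interp 0 Ha Hb.
have mS := measurable_strip.
move=> E0.
have : (\int[(leb \x P)%E]_(p in strip)
    `|((b p.1 p.2 - a p.1 p.2) ^+ 2)%:E| = 0)%E.
  under eq_integral do rewrite gee0_abs ?lee_fin ?sqr_ge0//.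
  by rewrite -[LHS]fineK ?(integrable_fin_num mS)//; congr (_%:E).
move=> /(ae_eq_integral_abs _ mS (measurable_int _ id)).
apply: filterS => -[t w] /= h tT.
have /h/eqP : strip (t, w) by split => //=; rewrite in_itv.
by rewrite eqe sqrf_eq0 subr_eq0 eq_sym => /eqP.
Qed.

End controls.

(** * First-order optimality *)

(** By the mean value theorem the increment is f'(c) h with c between x and x + h, and f'(c) differs
    from f'(x) by at most C |h|. This gives C where integration would give C / 2; only the order h^2
    matters. *)
Lemma descent_bound (R : realType) (f : R -> R) (C x h : R) :
  (forall y, derivable f y 1) ->
  (forall y z, `|derive1 f y - derive1 f z| <= C * `|y - z|) ->
  f (x + h) - f x <= derive1 f x * h + C * h ^+ 2.
Proof.
move=> df fC.
have fD (y : R) : is_derive y (1 : R) f (derive1 f y).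
  by rewrite derive1E; apply: DeriveDef.
have cf (A : set R) : {within A, continuous f}.
  apply: continuous_subspaceT => y.
  exact/differentiable_continuous/derivable1_diffP/df.
have C0 : 0 <= C by have := fC 1 0; rewrite subr0 normr1 mulr1; exact: le_trans.
have key c : `|c - x| <= `|h| -> derive1 f c * h <= derive1 f x * h + C * h ^+ 2.
  move=> cx; rewrite -lerBlDl -mulrBl; apply: le_trans (ler_norm _) _.
  rewrite normrM -(real_normK (num_real h)) expr2 mulrA ler_wpM2r//.
  by apply: le_trans (fC _ _) _; rewrite ler_wpM2l.
have [h0|h0] := leP 0 h.
  have xh : x <= x + h by rewrite lerDl.
  have [c cI ->] := MVT_segment xh (fun y _ => fD y) (cf _).
  rewrite addrAC subrr add0r; apply: key.
  move: cI; rewrite in_itv/= => /andP[? ?].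
  by rewrite !ger0_norm//; lra.
have xh : x + h <= x by rewrite gerDl ltW.
have [c cI E] := MVT_segment xh (fun y _ => fD y) (cf _).
rewrite -opprB E opprD addrA subrr add0r mulrN opprK; apply: key.
move: cI; rewrite in_itv/= => /andP[? ?].
by rewrite ler0_norm ?ltr0_norm//; lra.
Qed.

Lemma sqr_integrable_lin (R : realType) (d : measure_display)
    (T : measurableType d) (mu : {measure set T -> \bar R}) (k : R)
    (f g : T -> R) :
  measurable_fun setT f -> measurable_fun setT g ->
  mu.-integrable setT (fun x => ((f x) ^+ 2)%:E) ->
  mu.-integrable setT (fun x => ((g x) ^+ 2)%:E) ->
  mu.-integrable setT (fun x => ((f x + k * g x) ^+ 2)%:E).
Proof.
move=> mf mg f2 g2; have fg := integrable_mul_sqr measurableT mf mg f2 g2.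
have := integrableD measurableT (integrableD measurableT f2
  (integrableZl measurableT (2 * k) fg)) (integrableZl measurableT (k ^+ 2) g2).
by apply: eq_integrable => // x _ /=; congr (_%:E); ring.
Qed.

(** * Measurability of the filtrations and of the terminal state *)

Lemma sigma_rv_measurable (R : realType) (d : measure_display)
    (Omega : measurableType d) (Y : Omega -> R) :
  measurable_fun setT Y -> sigma_rv Y `<=` measurable.
Proof.
move=> mY _ [B mB <-]; exact: mY.
Qed.

Lemma sigma_process_measurable (R : realType) (d : measure_display)
    (Omega : measurableType d) (D : set R) (Y : R -> Omega -> R) :
  (forall s, D s -> measurable_fun setT (Y s)) ->
  sigma_process D Y `<=` measurable.
Proof.
move=> mY; apply: smallest_sub; first exact: sigma_algebra_measurable.
by move=> A [s Ds]; exact: sigma_rv_measurable (mY s Ds) A.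
Qed.

(** Completeness of [P] makes the negligible sets added by the augmentation measurable. *)
Lemma filtration_measurable (R : realType) (d : measure_display)
    (Omega : measurableType d) (P : probability Omega R) (T : R)
    (xi0 : Omega -> R) (W Wt : R -> Omega -> R) :
  measure_is_complete P -> brownian P T W -> brownian P T Wt ->
  measurable_fun setT xi0 ->
  filtration P xi0 W Wt T `<=` measurable /\
  common_filtration P Wt T `<=` measurable.
Proof.
move=> cP bW bWt mxi.
have mW : sigma_process `[0, T] W `<=` measurable.
  apply: sigma_process_measurable => s; rewrite /= in_itv/=.
  exact: (brownian_measurable bW).
have mWt : sigma_process `[0, T] Wt `<=` measurable.
  apply: sigma_process_measurable => s; rewrite /= in_itv/=.
  exact: (brownian_measurable bWt).
have mxi' := sigma_rv_measurable mxi.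
split; apply: smallest_sub; try exact: sigma_algebra_measurable.
  by move=> A [[[/mxi'//|/mW//]|/mWt//]|/cP].
by move=> A [/mWt//|/cP].
Qed.

Lemma state_sqr_integrable (R : realType) (d : measure_display)
    (Omega : measurableType d) (P : probability Omega R) (T sigma sigmat : R)
    (xi0 : Omega -> R) (W Wt a : R -> Omega -> R) (F : R -> set (set Omega)) :
  0 < T -> sigma_algebra setT (F T) -> F T `<=` measurable ->
  brownian P T W -> brownian P T Wt -> measurable_fun setT xi0 ->
  (\int[P]_w ((xi0 w) ^+ 2)%:E < +oo)%E -> H2 P T F a ->
  measurable_fun setT (state sigma sigmat xi0 W Wt a T) /\
  P.-integrable setT (fun w => ((state sigma sigmat xi0 W Wt a T w) ^+ 2)%:E).
Proof.
move=> T0 sF Fm bW bWt mxi xi2 Ha.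
have [md d2] := H2_drift T0 sF Fm Ha.
have mW : measurable_fun setT (W T).
  by apply: (brownian_measurable bW); rewrite lexx ltW.
have mWt : measurable_fun setT (Wt T).
  by apply: (brownian_measurable bWt); rewrite lexx ltW.
have W2 := brownian_sqr_integrable T0 bW.
have Wt2 := brownian_sqr_integrable T0 bWt.
have x2 : P.-integrable setT (fun w => ((xi0 w) ^+ 2)%:E).
  apply/integrableP; split; first by apply/measurable_EFinP; exact: measurable_funX.
  by under eq_integral do rewrite gee0_abs ?lee_fin ?sqr_ge0//.
pose f1 w := xi0 w + 1 * drift T a w; pose f2 w := f1 w + sigma * W T w.
have m1 : measurable_fun setT f1.
  by apply: measurable_funD => //; apply: measurable_funM.
have m2 : measurable_fun setT f2.
  by apply: measurable_funD => //; apply: measurable_funM.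
have i1 : P.-integrable setT (fun w => ((f1 w) ^+ 2)%:E).
  exact: sqr_integrable_lin.
have i2 : P.-integrable setT (fun w => ((f2 w) ^+ 2)%:E).
  exact: sqr_integrable_lin.
have -> : state sigma sigmat xi0 W Wt a T = (fun w => f2 w + sigmat * Wt T w).
  by apply/funext => w; rewrite /f2 /f1 mul1r.
split; last exact: sqr_integrable_lin.
by apply: measurable_funD => //; apply: measurable_funM.
Qed.

(** * Uniqueness of the equilibrium *)

Theorem theorem4p3 (R : realType) (d : measure_display) (Omega : measurableType d)
    (P : probability Omega R) (T sigma sigmat : R)
    (xi0 : {RV P >-> R}) (W Wt : R -> Omega -> R)
    (g : R -> P2 R -> R) (Cg : R) :
  measure_is_complete P ->
  0 < T ->
  brownian P T W ->
  brownian P T Wt ->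
  indep P (sigma_process `[0, T] W) (sigma_process `[0, T] Wt) ->
  (\int[P]_w ((xi0 w) ^+ 2)%:E < +oo)%E ->
  indep P (sigma_rv xi0)
    <<s sigma_process `[0, T] W `|` sigma_process `[0, T] Wt >> ->
  finite_costs P T sigma sigmat xi0 W Wt g ->
  (forall (x : R) (m : P2 R), derivable (fun y : R => g y m) x 1) ->
  (forall (x x' : R) (m : P2 R),
     `|partial_x g x m - partial_x g x' m| <= Cg * `|x - x'|) ->
  (forall (x x' : R) (m : P2 R),
     0 <= (partial_x g x m - partial_x g x' m) * (x - x')) ->
  (forall (x : R) (m m' : P2 R),
     `|partial_x g x m - partial_x g x m'| <= Cg * W2 m m') ->
  (forall (m m' : P2 R) (gamma : probability (R * R)%type R),
     (\int[gamma]_p (p.1 ^+ 2 + p.2 ^+ 2)%:E < +oo)%E ->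
     coupling m m' gamma ->
     (0 <= \int[gamma]_p
        ((partial_x g p.1 m - partial_x g p.2 m') * (p.1 - p.2))%:E)%E) ->
  forall a b : R -> Omega -> R,
    mfg_solution P T sigma sigmat xi0 W Wt g a ->
    mfg_solution P T sigma sigmat xi0 W Wt g b ->
    H2_eq P T a b.
Proof.
move=> cP T0 bW bWt _ xi2 _ [_ fin] gd gxC _ gxW mono a b
  [Ha [ma cfa opta]] [Hb [mb cfb optb]].
have mxi : measurable_fun setT xi0 by exact: measurable_funP.
pose F := filtration P xi0 W Wt; pose X := state sigma sigmat xi0 W Wt.
have [Fm cFm] := filtration_measurable cP bW bWt mxi.
have sF : sigma_algebra setT (F T) by exact: smallest_sigma_algebra.
have scF : sigma_algebra setT (common_filtration P Wt T).
  exact: smallest_sigma_algebra.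
have TT : 0 <= T <= T by rewrite lexx ltW.
have [mXa Xa2] := state_sqr_integrable sigma sigmat T0 sF Fm bW bWt mxi xi2 Ha.
have [mXb Xb2] := state_sqr_integrable sigma sigmat T0 sF Fm bW bWt mxi xi2 Hb.
rewrite -/(X a) in mXa Xa2; rewrite -/(X b) in mXb Xb2.
have C0 : 0 <= Cg.
  by have := gxC 1 0 (ma T point); rewrite subr0 normr1 mulr1; exact: le_trans.
have D2 : P.-integrable setT (fun w => ((X b T w - X a T w) ^+ 2)%:E).
  have := sqr_integrable_lin (-1) mXb mXa Xb2 Xa2.
  by apply: eq_integrable => // w _; rewrite mulN1r.
pose V := \int[P]_w ((X b T w - X a T w) ^+ 2).
have V0 : 0 <= V by apply: Rintegral_ge0 => w _; exact: sqr_ge0.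
pose D := energy P T (fun t w => b t w - a t w).
have D0 : 0 <= D by apply: Rintegral_ge0 => p _; exact: sqr_ge0.
apply: (energy_eq0 T0 sF Fm Ha Hb); rewrite -/D.
(* (1 - e) D comes from the strong convexity of the energies, 2 e Cg V from the second-order errors
   in [g]; as e tends to 0, D is forced to be 0. *)
suff bound e : 0 < e -> e < 1 -> (1 - e) * D <= 2 * e * Cg * V.
  apply/eqP; rewrite eq_le D0 andbT leNgt; apply/negP => Dp.
  pose M := 2 * Cg * V.
  have M0 : 0 <= M by rewrite /M !mulr_ge0.
  have DM : 0 < D + M by rewrite ltr_wpDr.
  (* The bound reads D <= e (D + M), which this choice turns into D <= D / 2. *)
  pose e := D / (2 * (D + M)).
  have eE : e * (D + M) = D / 2 by rewrite /e; field; rewrite gt_eqF.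
  have e0 : 0 < e by rewrite divr_gt0// mulr_gt0.
  have e1 : e < 1 by rewrite ltr_pdivrMr ?mulr_gt0// mul1r; lra.
  have := bound _ e0 e1.
  have -> : 2 * e * Cg * V = e * M by rewrite /M; ring.
  by move: eE; rewrite mulrDr => eE; lra.
move=> e0 e1.
have e01 : 0 <= e <= 1 by rewrite !ltW.
pose c t w := a t w + e * (b t w - a t w).
pose c' t w := b t w + e * (a t w - b t w).
have Hc : H2 P T F c by exact: H2_interp.
have Hc' : H2 P T F c' by exact: H2_interp.
have [Ec _] := energy_interp T0 sF Fm e Ha Hb.
have [Ec' _] := energy_interp T0 sF Fm e Hb Ha.
rewrite -/c -/D in Ec; rewrite -/c' in Ec'.
have DE : energy P T (fun t w => a t w - b t w) = D.
  by apply: eq_Rintegral => p _; rewrite -sqrrN opprB.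
rewrite {}DE in Ec'.
have ga := fin _ _ Ha Ha _ cfa; have gc := fin _ _ Hc Ha _ cfa.
have gb := fin _ _ Hb Hb _ cfb; have gc' := fin _ _ Hc' Hb _ cfb.
rewrite -/(X _) in ga gc gb gc'.
have := opta _ Hc; have := optb _ Hc'.
rewrite !(cost_energy T0 sF Fm)// !lee_fin Ec Ec'.
set Ga := \int[P]_w g (X a T w) (ma T w); set Gb := \int[P]_w g (X b T w) (mb T w).
set Gc := \int[P]_w g (X c T w) (ma T w).
set Gc' := \int[P]_w g (X c' T w) (mb T w).
move=> hb ha.
(* When the two optimality inequalities are added, the energies cancel up to e (1 - e) D, which is
   therefore at most the expectation of [inc]. *)
pose inc w := (g (X c T w) (ma T w) - g (X a T w) (ma T w)) +
  (g (X c' T w) (mb T w) - g (X b T w) (mb T w)).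
have j1 := integrableB measurableT gc ga.
have j2 := integrableB measurableT gc' gb.
have inci : P.-integrable setT (EFin \o inc).
  by have := integrableD measurableT j1 j2; apply: eq_integrable => // w _.
have incE : \int[P]_w inc w = (Gc - Ga) + (Gc' - Gb).
  by rewrite /inc RintegralD// ?RintegralB.
(* Each of the two increments of [g] exceeds its linear part by at most e^2 Cg (X^b - X^a)^2. After
   division by e, subtracting both errors leaves a minorant of the product to which monotonicity
   applies. *)
pose G w := e^-1 * inc w - 2 * e * Cg * (X b T w - X a T w) ^+ 2.
have k1 := integrableZl measurableT e^-1 inci.
have k2 := integrableZl measurableT (2 * e * Cg) D2.
have Gi : P.-integrable setT (EFin \o G).
  by have := integrableB measurableT k1 k2; apply: eq_integrable => // w _.
have GE : \int[P]_w G w = e^-1 * \int[P]_w inc w - 2 * e * Cg * V.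
  by rewrite /G RintegralB// !RintegralZl.
have incr (m : P2 R) x h :
    g (x + e * h) m - g x m <= e * (partial_x g x m * h) + e ^+ 2 * (Cg * h ^+ 2).
  have := descent_bound x (e * h) (fun y => gd y m) (fun y z => gxC y z m).
  by rewrite /partial_x exprMn; lra.
have Gle : {ae P, forall w, G w <=
    (partial_x g (X a T w) (ma T w) - partial_x g (X b T w) (mb T w)) *
    (X b T w - X a T w)}.
  have dc := drift_interp T0 sF Fm e Ha Hb; have dc' := drift_interp T0 sF Fm e Hb Ha.
  apply: filterS2 dc dc' => w dcw dcw'.
  have Xc : X c T w = X a T w + e * (X b T w - X a T w).
    by rewrite /X /state -!/(drift _ _ _) dcw; ring.
  have Xc' : X c' T w = X b T w + e * (X a T w - X b T w).
    by rewrite /X /state -!/(drift _ _ _) dcw'; ring.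
  rewrite /G /inc Xc Xc' lerBlDr.
  rewrite mulrC ler_pdivrMr//.
  have := incr (ma T w) (X a T w) (X b T w - X a T w).
  have := incr (mb T w) (X b T w) (X a T w - X b T w).
  by move: (g _ _) (g _ _) (g _ _) (g _ _) (partial_x _ _ _) (partial_x _ _ _) => *; lra.
have := cond_law_monotone scF cFm mXa mXb Xa2 Xb2 (cfa _ TT) (cfb _ TT) C0
  gxC gxW mono Gi Gle.
rewrite GE subr_le0 incE => h.
move: h; rewrite mulrC ler_pdivrMr// => h.
rewrite -(ler_pM2l e0); lra.
Qed.
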